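(* For every Euclidean zero-set $\widetilde{\mathcal Z}$ with finite area, $$\lim_{\alpha\to1^-}\frac{\widetilde I(\alpha,0,\widetilde{\mathcal Z})}{1-\alpha}=\mathrm{area}(\widetilde{\mathcal Z}),\qquad \lim_{\alpha\to1^-}\frac{\widetilde I(\alpha,\alpha,\widetilde{\mathcal Z})}{1-\alpha}=\widetilde\gamma_{\rm thin}(\widetilde{\mathcal Z}).$$ Moreover, with the supremum over Euclidean zero-sets $\widetilde{\mathcal Z}$ with finite positive area, $$\sup_{\widetilde{\mathcal Z}}\frac{\widetilde I(\alpha,\alpha,\widetilde{\mathcal Z})}{\widetilde\gamma(\widetilde{\mathcal Z})}=\begin{cases}1+o(\alpha),&\alpha\to0^+,\\ 2(1-\alpha)+o(1-\alpha),&\alpha\to1^-.\end{cases}$$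
   Context: $\widetilde R_{a,b}=[0,a]\times[0,b]$. A Euclidean zero-set is a closed $\widetilde{\mathcal Z}\subseteq[0,\infty)^2$ such that $(a,b)\in\widetilde{\mathcal Z}$ implies $\widetilde R_{a,b}\subseteq\widetilde{\mathcal Z}$, and $\widetilde{\mathcal Z}$ is the closure of $\widetilde{\mathcal Z}\cap(0,\infty)^2$. For Borel $A\subseteq[0,\infty)^2$, $\widetilde{\mathrm{row}}(x,A)$ (resp. $\widetilde{\mathrm{col}}(x,A)$) is the 1-dimensional Lebesgue measure of $A$ intersected with the horizontal (resp. vertical) line through $x$. For left-continuous nonincreasing $f,g:[0,\infty)\to[0,\infty)$ of compact support, $\widetilde{\mathcal T}(A)=A\cup\{(u,v):(\widetilde{\mathrm{row}}((u,v),A)+f(v),\widetilde{\mathrm{col}}((u,v),A)+g(u))\notin\widetilde{\mathcal Z}\}$; $A$ E-spans for $(\widetilde{\mathcal Z},f,g)$ if $\bigcup_n\widetilde{\mathcal T}^n(A)=[0,\infty)^2$. For bounded $\widetilde{\mathcal Z}$ and $(\alpha,\beta)\in[0,1]^2$: $\widetilde I(\alpha,\beta,\widetilde{\mathcal Z})=\inf\{\mathrm{area}(A)+(1-\alpha)\int_0^\infty f+(1-\beta)\int_0^\infty g\}$ over all $(A,f,g)$ with $A$ compact E-spanning for $(\widetilde{\mathcal Z},f,g)$; $\widetilde\gamma_{\rm thin}(\widetilde{\mathcal Z})=\inf\{\int f+\int g:\emptyset\text{ E-spans for }(\widetilde{\mathcal Z},f,g)\}$. For general $\widetilde{\mathcal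 Z}$ both are defined as $\lim_{R\to\infty}$ of the values for $\widetilde{\mathcal Z}\cap[0,R]^2$. $\widetilde\gamma(\widetilde{\mathcal Z})=\widetilde I(0,0,\widetilde{\mathcal Z})$. *)

(* Defs.v *)
From Stdlib Require Import Reals ClassicalEpsilon.
Open Scope R_scope.

Inductive Rbar := Fin (r : R) | PInf | MInf.

Definition Rbar_le (x y : Rbar) : Prop :=
  match x, y with
  | MInf, _ => True
  | _, PInf => True
  | Fin a, Fin b => a <= b
  | _, _ => False
  end.

Definition is_lub_Rbar (P : Rbar -> Prop) (v : Rbar) : Prop :=
  (forall x, P x -> Rbar_le x v) /\
  (forall w, (forall x, P x -> Rbar_le x w) -> Rbar_le v w).
Definition is_glb_Rbar (P : Rbar -> Prop) (v : Rbar) : Prop :=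
  (forall x, P x -> Rbar_le v x) /\
  (forall w, (forall x, P x -> Rbar_le w x) -> Rbar_le w v).

(** sup / inf in the extended reals (they always exist) *)
Definition Rbar_sup (P : Rbar -> Prop) : Rbar :=
  epsilon (inhabits PInf) (is_lub_Rbar P).
Definition Rbar_inf (P : Rbar -> Prop) : Rbar :=
  epsilon (inhabits PInf) (is_glb_Rbar P).

(** multiplication by a real scalar (used only with c > 0) *)
Definition Rbar_scale (c : R) (x : Rbar) : Rbar :=
  match x with Fin a => Fin (c * a) | y => y end.
Definition Rbar_addr (x : Rbar) (r : R) : Rbar :=
  match x with Fin a => Fin (a + r) | y => y end.

(** sum of a series of nonnegative terms, in [0, +oo] *)
Definition series_Rbar (f : nat -> R) : Rbar :=
  Rbar_sup (fun v => exists n, v = Fin (sum_f_R0 f n)).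

Definition lm1 (E : R -> Prop) : Rbar :=
  Rbar_inf (fun v => exists a b : nat -> R,
    (forall n, a n <= b n) /\
    (forall x, E x -> exists n, a n <= x <= b n) /\
    v = series_Rbar (fun n => b n - a n)).

Definition lm2 (E : R -> R -> Prop) : Rbar :=
  Rbar_inf (fun v => exists a1 b1 a2 b2 : nat -> R,
    (forall n, a1 n <= b1 n /\ a2 n <= b2 n) /\
    (forall x y, E x y -> exists n, a1 n <= x <= b1 n /\ a2 n <= y <= b2 n) /\
    v = series_Rbar (fun n => (b1 n - a1 n) * (b2 n - a2 n))).

Definition area (E : R -> R -> Prop) : Rbar := lm2 E.

Definition row (A : R -> R -> Prop) (u v : R) : Rbar := lm1 (fun x => A x v).
Definition col (A : R -> R -> Prop) (u v : R) : Rbar := lm1 (fun y => A u y).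

Definition quadrant (u v : R) : Prop := 0 <= u /\ 0 <= v.
Definition closure2 (S : R -> R -> Prop) (x y : R) : Prop :=
  forall eps, eps > 0 -> exists u v, S u v /\ Rabs (u - x) < eps /\ Rabs (v - y) < eps.
Definition is_closed2 (S : R -> R -> Prop) : Prop :=
  forall x y, closure2 S x y -> S x y.
Definition bounded2 (S : R -> R -> Prop) : Prop :=
  exists M, forall x y, S x y -> Rabs x <= M /\ Rabs y <= M.
Definition compact2 (S : R -> R -> Prop) : Prop := is_closed2 S /\ bounded2 S.

Definition zero_set (Z : R -> R -> Prop) : Prop :=
  (forall x y, Z x y -> quadrant x y) /\
  is_closed2 Z /\
  (forall a b, Z a b -> forall x y, 0 <= x <= a -> 0 <= y <= b -> Z x y) /\
  (forall x y, Z x y <-> closure2 (fun u v => Z u v /\ 0 < u /\ 0 < v) x y).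

Definition profile (f : R -> R) : Prop :=
  (forall x, 0 <= x -> 0 <= f x) /\
  (forall x y, 0 <= x <= y -> f y <= f x) /\
  (forall x, 0 < x -> forall eps, eps > 0 -> exists d, d > 0 /\
       forall y, 0 <= y -> x - d < y <= x -> Rabs (f y - f x) < eps) /\
  (exists M, forall x, M <= x -> f x = 0).

(** integral over [0,oo) of a nonnegative function = area of its subgraph *)
Definition integral0 (f : R -> R) : Rbar :=
  lm2 (fun x y => 0 <= x /\ 0 <= y /\ y < f x).

Definition inZbar (Z : R -> R -> Prop) (p q : Rbar) : Prop :=
  match p, q with Fin a, Fin b => Z a b | _, _ => False end.

Definition Top (Z : R -> R -> Prop) (f g : R -> R) (A : R -> R -> Prop) : R -> R -> Prop :=
  fun u v => quadrant u v /\
    (A u v \/ ~ inZbar Z (Rbar_addr (row A u v) (f v)) (Rbar_addr (col A u v) (g u))).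

Definition iterT (Z : R -> R -> Prop) (f g : R -> R) (n : nat) (A : R -> R -> Prop) :=
  Nat.iter n (Top Z f g) A.

Definition spans (Z : R -> R -> Prop) (f g : R -> R) (A : R -> R -> Prop) : Prop :=
  forall u v, quadrant u v -> exists n, iterT Z f g n A u v.

Definition I_bdd (al be : R) (Z : R -> R -> Prop) : Rbar :=
  Rbar_inf (fun w => exists (A : R -> R -> Prop) (f g : R -> R) (a i1 i2 : R),
    compact2 A /\ (forall u v, A u v -> quadrant u v) /\
    profile f /\ profile g /\ spans Z f g A /\
    area A = Fin a /\ integral0 f = Fin i1 /\ integral0 g = Fin i2 /\
    w = Fin (a + (1 - al) * i1 + (1 - be) * i2)).

Definition gthin_bdd (Z : R -> R -> Prop) : Rbar :=
  Rbar_inf (fun w => exists (f g : R -> R) (i1 i2 : R),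
    profile f /\ profile g /\ spans Z f g (fun _ _ => False) /\
    integral0 f = Fin i1 /\ integral0 g = Fin i2 /\ w = Fin (i1 + i2)).

Definition truncate (Z : R -> R -> Prop) (M : R) : R -> R -> Prop :=
  fun x y => Z x y /\ x <= M /\ y <= M.

Definition Rbar_lim_infty (h : R -> Rbar) (L : Rbar) : Prop :=
  match L with
  | Fin l => forall eps, eps > 0 -> exists M, forall r, M <= r ->
               exists y, h r = Fin y /\ Rabs (y - l) < eps
  | PInf => forall K, exists M, forall r, M <= r -> Rbar_le (Fin K) (h r)
  | MInf => forall K, exists M, forall r, M <= r -> Rbar_le (h r) (Fin K)
  end.
Definition RbarLim (h : R -> Rbar) : Rbar :=
  epsilon (inhabits PInf) (Rbar_lim_infty h).

Definition Rbar_lim_left (h : R -> Rbar) (x0 : R) (L : Rbar) : Prop :=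
  match L with
  | Fin l => forall eps, eps > 0 -> exists d, d > 0 /\ forall x, x0 - d < x < x0 ->
               exists y, h x = Fin y /\ Rabs (y - l) < eps
  | PInf => forall K, exists d, d > 0 /\ forall x, x0 - d < x < x0 -> Rbar_le (Fin K) (h x)
  | MInf => forall K, exists d, d > 0 /\ forall x, x0 - d < x < x0 -> Rbar_le (h x) (Fin K)
  end.

Definition EI (al be : R) (Z : R -> R -> Prop) : Rbar :=
  RbarLim (fun M => I_bdd al be (truncate Z M)).
Definition gamma_thin (Z : R -> R -> Prop) : Rbar :=
  RbarLim (fun M => gthin_bdd (truncate Z M)).
Definition gamma (Z : R -> R -> Prop) : Rbar := EI 0 0 Z.

(** ratio x / y of extended reals (y = 0 or y = +oo handled by convention) *)
Definition ratio_val (x y : Rbar) : Rbar :=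
  match y with
  | Fin g => if Rlt_dec 0 g then Rbar_scale (/ g) x else PInf
  | PInf => match x with Fin _ => Fin 0 | z => z end
  | MInf => PInf
  end.

Definition sup_ratio (al : R) : Rbar :=
  Rbar_sup (fun w => exists (Z : R -> R -> Prop) (a : R),
    zero_set Z /\ area Z = Fin a /\ 0 < a /\ w = ratio_val (EI al al Z) (gamma Z)).

(* Main.v *)
Require Import Defs.
From Stdlib Require Import Reals Lra Lia Compare_dec Classical ClassicalEpsilon.
From Stdlib Require Import FunctionalExtensionality PropExtensionality.
Open Scope R_scope.

(** Rearrangement: if (A, f, g) spans, then so does the empty set with the decreasing rearrangements
    of f + row(A) and g + col(A), since an interval exchange in each coordinate carries the growth
    from A into the growth from the empty set.  Hence gamma_thin <= int f + int g + 2 area(A), which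
    gives I(al, al) = (1 - al) gamma_thin for al >= 1/2 and gamma_thin <= 2 gamma.

    Barrier: if the empty set spans for (f, g), then (t + f v, v + g t) lies outside Z for all
    t, v >= 0.  When int g is small this forces int f to be almost area(Z), which gives the limit of
    I(al, 0) / (1 - al); the upper bound comes from taking for f the profile of Z itself.

    Sharpness: for the L-shape with arms of length 1 and width d = 1/N, N diagonal squares of side
    slightly above d span, so gamma <= d, whereas the barrier property on the two arms gives
    gamma_thin >= 2 d (1 - d).  Thus sup I(al, al) / gamma = min(1, 2 (1 - al)) for 0 < al < 1. *)

(** * Extended reals *)

(** The functions [lm1] and [lm2] are outer measures, and no measurability is established for the
    sets that the growth produces. So only facts valid for every set are used: subadditivity,
    invariance under translation, reflection and swap, additivity across cuts along coordinate
    lines, and the exact measure of intervals and rectangles. For this reason integrals are compared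
    through step functions, and the interval exchange moves finitely many grid cells.

    The exchange works because the test at a point sees the occupied set only through the measures
    of one row and one column. The part due to A has been moved into the new profiles, and the
    measure of the rest does not change when coordinates are rearranged. Sorting is what makes the
    new functions profiles.

    The constant 1/2 comes from counting area(A) twice: [a + (1 - al) * (i1 + i2)] is at least
    [Rmin (1 - al) (1 / 2)] times [2 * a + i1 + i2]. In the limit of I(al, 0), a competitive triple
    costs at most (1 - al) area(Z), so both area(A) and int g tend to 0; hence the rearranged g is
    small as well. *)

Lemma Rbar_le_refl (x : Rbar) : Rbar_le x x.
Proof. destruct x; simpl; auto; lra. Qed.

Lemma Rbar_le_antisym (x y : Rbar) : Rbar_le x y -> Rbar_le y x -> x = y.
Proof. destruct x, y; simpl; try tauto; intros; f_equal; lra. Qed.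

(** Existence must come first: [Rbar_sup] and [Rbar_inf] are choices by [epsilon], which say nothing
    until a bound is known to exist. *)
Lemma is_lub_Rbar_exists (P : Rbar -> Prop) : exists v, is_lub_Rbar P v.
Proof.
destruct (classic (P PInf)) as [HP|HP].
{ exists PInf; split; [intros [ | | ]; simpl; auto|].
  intros w Hw; exact (Hw _ HP). }
destruct (classic (exists r, P (Fin r))) as [[r Hr]|Hn].
- destruct (classic (exists K, forall r, P (Fin r) -> r <= K)) as [[K HK]|Hunb].
  + destruct (completeness (fun r => P (Fin r))) as [m [Hm1 Hm2]].
    * exists K; intros x Hx; auto.
    * exists r; auto.
    * exists (Fin m); split.
      -- intros [x| |] Hx; simpl; auto.
      -- intros [w| |] Hw; simpl; auto.
         ++ apply Hm2; intros x Hx; exact (Hw _ Hx).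
         ++ exact (Hw _ Hr).
  + exists PInf; split; [intros [ | | ]; simpl; auto|].
    intros [w| |] Hw; simpl; auto.
    * apply Hunb; exists w; intros x Hx; exact (Hw _ Hx).
    * exact (Hw _ Hr).
- exists MInf; split; [|intros [ | | ]; simpl; auto].
  intros [x| |] Hx; simpl; auto.
  apply Hn; eauto.
Qed.

Lemma Rbar_sup_spec (P : Rbar -> Prop) : is_lub_Rbar P (Rbar_sup P).
Proof. unfold Rbar_sup; apply epsilon_spec, is_lub_Rbar_exists. Qed.

Lemma Rbar_inf_spec (P : Rbar -> Prop) : is_glb_Rbar P (Rbar_inf P).
Proof.
unfold Rbar_inf; apply epsilon_spec.
destruct (is_lub_Rbar_exists (fun w => forall x, P x -> Rbar_le w x)) as [v [H1 H2]].
exists v; split.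
- intros x Hx; apply H2; intros w Hw; auto.
- intros w Hw; apply H1; auto.
Qed.

Lemma Rbar_sup_unique (P : Rbar -> Prop) (v : Rbar) : is_lub_Rbar P v -> Rbar_sup P = v.
Proof.
intros [H1 H2]; destruct (Rbar_sup_spec P) as [H3 H4].
apply Rbar_le_antisym; auto.
Qed.

Lemma Rbar_inf_Fin (P : Rbar -> Prop) (K : R) :
  (exists r, P (Fin r)) -> (forall x, P x -> Rbar_le (Fin K) x) ->
  exists m, Rbar_inf P = Fin m /\ K <= m /\ (forall r, P (Fin r) -> m <= r) /\
    (forall c, (forall x, P x -> Rbar_le (Fin c) x) -> c <= m).
Proof.
intros [r Hr] H0.
destruct (Rbar_inf_spec P) as [H1 H2].
destruct (Rbar_inf P) as [m| |].
- exists m; split; [easy|]; split; [exact (H2 (Fin K) H0)|]; split.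
  + intros x Hx; exact (H1 _ Hx).
  + intros c Hc; exact (H2 (Fin c) Hc).
- contradiction (H1 _ Hr).
- contradiction (H2 (Fin K) H0).
Qed.

Lemma series_Rbar_le (f : nat -> R) (s : R) :
  Rbar_le (series_Rbar f) (Fin s) <-> forall n, sum_f_R0 f n <= s.
Proof.
unfold series_Rbar.
destruct (Rbar_sup_spec (fun v => exists n, v = Fin (sum_f_R0 f n))) as [H1 H2].
split.
- intros H n.
  assert (Hn := H1 _ (ex_intro _ n eq_refl)).
  destruct (Rbar_sup _); simpl in *; try tauto; lra.
- intros H; apply H2; intros x [n ->]; exact (H n).
Qed.

(** * Finite sums *)

Fixpoint Sum (n : nat) (f : nat -> R) : R :=
  match n with O => 0 | S k => Sum k f + f k end.

Lemma sum_f_R0_Sum (f : nat -> R) (n : nat) : sum_f_R0 f n = Sum (S n) f.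
Proof. induction n; simpl in *; [ring|rewrite IHn; simpl; ring]. Qed.

Lemma Sum_ext n f g : (forall i, (i < n)%nat -> f i = g i) -> Sum n f = Sum n g.
Proof.
induction n; simpl; intros H; auto.
rewrite IHn, (H n); auto.
Qed.

Lemma Sum_le n f g : (forall i, (i < n)%nat -> f i <= g i) -> Sum n f <= Sum n g.
Proof.
induction n; simpl; intros H; [lra|].
apply Rplus_le_compat; auto.
Qed.

Lemma Sum_ge0 n f : (forall i, (i < n)%nat -> 0 <= f i) -> 0 <= Sum n f.
Proof.
induction n; simpl; intros H; [lra|].
assert (0 <= f n) by auto. assert (0 <= Sum n f) by auto. lra.
Qed.

Lemma Sum_plus n f g : Sum n (fun i => f i + g i) = Sum n f + Sum n g.
Proof. induction n; simpl; [ring|rewrite IHn; ring]. Qed.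

Lemma Sum_scal n c f : Sum n (fun i => c * f i) = c * Sum n f.
Proof. induction n; simpl; [ring|rewrite IHn; ring]. Qed.

Lemma Sum_const n c : Sum n (fun _ => c) = INR n * c.
Proof. induction n; [simpl; ring|cbn [Sum]; rewrite IHn, S_INR; ring]. Qed.

Lemma Sum_incr n m f : (n <= m)%nat -> (forall i, 0 <= f i) -> Sum n f <= Sum m f.
Proof.
intros Hnm Hf; induction Hnm; [lra|simpl; specialize (Hf m); lra].
Qed.

Lemma Sum_shift n f : Sum (S n) f = f O + Sum n (fun i => f (S i)).
Proof. induction n; [simpl; ring|]. cbn [Sum] in *; rewrite IHn; ring. Qed.

Lemma Sum_telescope n f : Sum n (fun i => f (S i) - f i) = f n - f O.
Proof. induction n; simpl; [ring|rewrite IHn; ring]. Qed.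

Lemma Sum_exchange n m (f : nat -> nat -> R) :
  Sum n (fun i => Sum m (f i)) = Sum m (fun j => Sum n (fun i => f i j)).
Proof.
induction n; simpl.
- rewrite Sum_const; ring.
- rewrite IHn, <- Sum_plus; reflexivity.
Qed.

Lemma Sum_term_le n f i : (i < n)%nat -> (forall i, 0 <= f i) -> f i <= Sum n f.
Proof.
intros Hi Hf; apply Rle_trans with (Sum (S i) f).
- simpl; assert (0 <= Sum i f) by (apply Sum_ge0; auto); lra.
- apply Sum_incr; auto.
Qed.

Lemma Sum_subst n m x f :
  (m < n)%nat -> Sum n (fun i => if Nat.eq_dec i m then x else f i) = Sum n f - f m + x.
Proof.
intros Hm; induction n; [lia|]; simpl.
destruct (Nat.eq_dec n m) as [->|Hn].
- rewrite (Sum_ext m _ f); [ring|].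
  intros i Hi; destruct (Nat.eq_dec i m); [lia|auto].
- rewrite IHn by lia; ring.
Qed.

Lemma Sum_half_pow n : Sum n (fun i => (/ 2) ^ S i) <= 1.
Proof.
assert (H : Sum n (fun i => (/ 2) ^ S i) = 1 - (/ 2) ^ n).
{ induction n; cbn [Sum]; [simpl; ring|rewrite IHn; simpl; field]. }
rewrite H; assert (0 < (/ 2) ^ n) by (apply pow_lt; lra); lra.
Qed.

(** * Outer measures generated by covers *)

Section Cover.

Variables (X J : Type) (valid : J -> Prop) (mem : J -> X -> Prop) (vol : J -> R).
Hypothesis vol_ge0 : forall j, valid j -> 0 <= vol j.
Variable j0 : J.
Hypothesis valid0 : valid j0.
Hypothesis vol0 : vol j0 = 0.

Definition covers (E : X -> Prop) (c : nat -> J) (s : R) : Prop :=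
  (forall n, valid (c n)) /\ (forall x, E x -> exists n, mem (c n) x) /\
  (forall n, Sum n (fun i => vol (c i)) <= s).

(** Encodes that the outer measure of [E] is at most [s]. Reasoning with this relation keeps
    infinite values out of the arithmetic. *)
Definition mle (E : X -> Prop) (s : R) : Prop :=
  forall eps, eps > 0 -> exists c, covers E c (s + eps).

Lemma mle_mono (E E' : X -> Prop) s s' :
  (forall x, E x -> E' x) -> s' <= s -> mle E' s' -> mle E s.
Proof.
intros HE Hs H eps Heps; destruct (H eps Heps) as [c [H1 [H2 H3]]].
exists c; split; [auto|split; [auto|]]; intros n; specialize (H3 n); lra.
Qed.

Lemma mle_ge0 (E : X -> Prop) s : mle E s -> 0 <= s.
Proof.
intros H; apply Rnot_lt_le; intros Hs.
destruct (H (- s / 2)) as [c [_ [_ H3]]]; [lra|].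
specialize (H3 O); simpl in H3; lra.
Qed.

Lemma mle_lim (E : X -> Prop) s : (forall eps, eps > 0 -> mle E (s + eps)) -> mle E s.
Proof.
intros H eps Heps; destruct (H (eps / 2) ltac:(lra) (eps / 2) ltac:(lra)) as [c Hc].
exists c; replace (s + eps) with (s + eps / 2 + eps / 2) by field; auto.
Qed.

Lemma mle_empty (E : X -> Prop) : (forall x, ~ E x) -> mle E 0.
Proof.
intros H eps Heps; exists (fun _ => j0); split; [auto|split].
- intros x Hx; contradiction (H x).
- intros n; rewrite Sum_const, vol0; lra.
Qed.

Lemma mle_one (E : X -> Prop) j : valid j -> (forall x, E x -> mem j x) -> mle E (vol j).
Proof.
intros Hj H eps Heps.
exists (fun n => match n with O => j | _ => j0 end); split; [intros [|n]; auto|split].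
- intros x Hx; exists O; auto.
- intros [|n]; [simpl; specialize (vol_ge0 j Hj); lra|].
  rewrite Sum_shift, Sum_const, vol0; lra.
Qed.

(** By [mle_lim] the admissible bounds form a closed set, so their infimum is itself a bound. These
    minima are the witnesses in [mle_split]. *)
Lemma mle_inf (E : X -> Prop) s :
  mle E s -> exists m, mle E m /\ m <= s /\ forall t, mle E t -> m <= t.
Proof.
intros Hs.
destruct (Rbar_inf_Fin (fun v => exists t, mle E t /\ v = Fin t) 0) as [m [_ [_ [H1 H2]]]].
- exists s, s; auto.
- intros x [t [Ht ->]]; exact (mle_ge0 _ _ Ht).
- exists m; split; [|split].
  + apply mle_lim; intros eps Heps; apply NNPP; intros Hn.
    assert (m + eps <= m); [|lra].
    apply H2; intros x [t [Ht ->]]; simpl.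
    apply Rnot_lt_le; intros Hlt; apply Hn.
    apply (mle_mono E E _ t); auto; lra.
  + apply H1; eauto.
  + intros t Ht; apply H1; eauto.
Qed.

Lemma mle_union (E1 E2 : X -> Prop) s1 s2 :
  mle E1 s1 -> mle E2 s2 -> mle (fun x => E1 x \/ E2 x) (s1 + s2).
Proof.
intros H1 H2 eps Heps.
destruct (H1 (eps / 2) ltac:(lra)) as [c1 [V1 [C1 S1]]].
destruct (H2 (eps / 2) ltac:(lra)) as [c2 [V2 [C2 S2]]].
(* Interleave the two covers: even indices run through [c1], odd ones through [c2]. *)
set (c := fun n => if Nat.even n then c1 (Nat.div2 n) else c2 (Nat.div2 n)).
assert (ce : forall n, c (2 * n)%nat = c1 n).
{ intros n; unfold c. rewrite Nat.even_mul, Nat.div2_double; reflexivity. }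
assert (co : forall n, c (S (2 * n)) = c2 n).
{ intros n; unfold c. rewrite Nat.even_succ, Nat.odd_mul, Nat.div2_succ_double; reflexivity. }
assert (V : forall n, valid (c n)) by (intros n; unfold c; destruct (Nat.even n); auto).
exists c; split; [auto|split].
- intros x [Hx|Hx].
  + destruct (C1 x Hx) as [n Hn]; exists (2 * n)%nat; rewrite ce; auto.
  + destruct (C2 x Hx) as [n Hn]; exists (S (2 * n)); rewrite co; auto.
- intros n; apply Rle_trans with (Sum (2 * n) (fun i => vol (c i))).
  + apply Sum_incr; [lia|auto].
  + assert (Hk : forall k, Sum (2 * k) (fun i => vol (c i)) =
      Sum k (fun i => vol (c1 i)) + Sum k (fun i => vol (c2 i))).
    { induction k; [simpl; ring|].
      replace (2 * S k)%nat with (S (S (2 * k))) by lia.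
      cbn [Sum]; rewrite IHk, ce, co; ring. }
    rewrite Hk; specialize (S1 n); specialize (S2 n); lra.
Qed.

Lemma mle_finite n (E : nat -> X -> Prop) (s : nat -> R) :
  (forall i, (i < n)%nat -> mle (E i) (s i)) ->
  mle (fun x => exists i, (i < n)%nat /\ E i x) (Sum n s).
Proof.
induction n; intros H; simpl.
- apply mle_empty; intros x [i [Hi _]]; lia.
- apply (mle_mono _ (fun x => (exists i, (i < n)%nat /\ E i x) \/ E n x)) with (s' := Sum n s + s n); [|lra|].
  + intros x [i [Hi Hx]]; destruct (Nat.eq_dec i n) as [->|]; [auto|].
    left; exists i; split; [lia|auto].
  + apply mle_union; auto.
Qed.

(** Here [phi j] is a box of the same volume that contains the preimage of [j] under [T];
    translation, reflection and swap are the instances. *)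
Lemma mle_map (T : X -> X) (phi : J -> J) (E : X -> Prop) s :
  (forall j, valid j -> valid (phi j) /\ vol (phi j) = vol j) ->
  (forall j x, valid j -> mem j (T x) -> mem (phi j) x) ->
  mle E s -> mle (fun x => E (T x)) s.
Proof.
intros H1 H2 H eps Heps; destruct (H eps Heps) as [c [V [C S]]].
exists (fun n => phi (c n)); split; [|split].
- intros n; apply H1; auto.
- intros x Hx; destruct (C _ Hx) as [n Hn]; exists n; auto.
- intros n; rewrite (Sum_ext _ _ (fun i => vol (c i))); auto.
  intros i _; apply H1; auto.
Qed.

(** Cutting every box of a cover in two gives covers of both parts whose volumes add up. This is the
    Caratheodory inequality for cuts compatible with boxes; it stands in for additivity
    throughout. *)
Lemma mle_split (phi1 phi2 : J -> J) (E E1 E2 : X -> Prop) s :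
  (forall j, valid j -> valid (phi1 j) /\ valid (phi2 j) /\ vol (phi1 j) + vol (phi2 j) = vol j) ->
  (forall j x, valid j -> E1 x -> E x /\ (mem j x -> mem (phi1 j) x)) ->
  (forall j x, valid j -> E2 x -> E x /\ (mem j x -> mem (phi2 j) x)) ->
  mle E s -> exists s1 s2, mle E1 s1 /\ mle E2 s2 /\ s1 + s2 <= s.
Proof.
intros Hphi H1 H2 H.
assert (M1 : mle E1 s) by (apply (mle_mono E1 E s s); auto; [intros x Hx; apply (H1 j0); auto|lra]).
assert (M2 : mle E2 s) by (apply (mle_mono E2 E s s); auto; [intros x Hx; apply (H2 j0); auto|lra]).
destruct (mle_inf _ _ M1) as [m1 [I1 [_ L1]]], (mle_inf _ _ M2) as [m2 [I2 [_ L2]]].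
exists m1, m2; split; [auto|split; [auto|]].
apply Rnot_lt_le; intros Hlt.
destruct (H ((m1 + m2 - s) / 2)) as [c [V [C S]]]; [lra|].
set (t := s + (m1 + m2 - s) / 2) in *.
assert (G1 : forall i, 0 <= vol (phi1 (c i))) by (intros i; apply vol_ge0, Hphi; auto).
assert (G2 : forall i, 0 <= vol (phi2 (c i))) by (intros i; apply vol_ge0, Hphi; auto).
(* The lengths [n] and [m] are independent so that [L1] can pass to the limit in the first sum with
   [m] fixed, and then [L2] in the second. *)
assert (Key : forall n m, Sum n (fun i => vol (phi1 (c i))) + Sum m (fun i => vol (phi2 (c i))) <= t).
{ intros n m.
  apply Rle_trans with (Sum (max n m) (fun i => vol (phi1 (c i))) + Sum (max n m) (fun i => vol (phi2 (c i)))).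
  - apply Rplus_le_compat; apply Sum_incr; auto; lia.
  - rewrite <- Sum_plus, (Sum_ext _ _ (fun i => vol (c i))); auto.
    intros i _; apply Hphi; auto. }
assert (B2 : forall m, m1 + Sum m (fun i => vol (phi2 (c i))) <= t).
{ intros m; assert (m1 <= t - Sum m (fun i => vol (phi2 (c i)))); [|lra].
  apply L1; intros eps Heps; exists (fun n => phi1 (c n)); split; [|split].
  - intros n; apply Hphi; auto.
  - intros x Hx; destruct (H1 (c O) x (V O) Hx) as [Ex _].
    destruct (C x Ex) as [n Hn]; exists n; apply (H1 (c n)); auto.
  - intros n; specialize (Key n m); lra. }
assert (m2 <= t - m1); [|unfold t in *; lra].
apply L2; intros eps Heps; exists (fun n => phi2 (c n)); split; [|split].
- intros n; apply Hphi; auto.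
- intros x Hx; destruct (H2 (c O) x (V O) Hx) as [Ex _].
  destruct (C x Ex) as [n Hn]; exists n; apply (H2 (c n)); auto.
- intros n; specialize (B2 n); lra.
Qed.

(* Enlarging the n-th set by eps / 2^(n+2) gives a cover by interiors. *)
Lemma mle_open_cover (omem : J -> X -> Prop) (E : X -> Prop) s eps :
  (forall j e, valid j -> e > 0 -> exists j', valid j' /\ vol j' <= vol j + e /\
     forall x, mem j x -> omem j' x) ->
  mle E s -> eps > 0 ->
  exists c, (forall n, valid (c n)) /\ (forall x, E x -> exists n, omem (c n) x) /\
    (forall n, Sum n (fun i => vol (c i)) <= s + eps).
Proof.
intros Henl H Heps.
destruct (H (eps / 2) ltac:(lra)) as [c [V [C Sc]]].
assert (Hp : forall n, eps / 2 * (/ 2) ^ S n > 0).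
{ intros n; apply Rmult_lt_0_compat; [lra|apply pow_lt; lra]. }
set (c' := fun n => proj1_sig (constructive_indefinite_description _ (Henl (c n) _ (V n) (Hp n)))).
assert (Hc' : forall n, valid (c' n) /\ vol (c' n) <= vol (c n) + eps / 2 * (/ 2) ^ S n /\
  forall x, mem (c n) x -> omem (c' n) x).
{ intros n; exact (proj2_sig (constructive_indefinite_description _ (Henl (c n) _ (V n) (Hp n)))). }
exists c'; split; [intros n; apply Hc'|split].
- intros x Hx; destruct (C x Hx) as [n Hn]; exists n; apply Hc'; auto.
- intros n.
  apply Rle_trans with (Sum n (fun i => vol (c i) + eps / 2 * (/ 2) ^ S i)).
  + apply Sum_le; intros i _; apply Hc'.
  + rewrite Sum_plus, Sum_scal; specialize (Sc n); assert (Hh := Sum_half_pow n).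
    assert (eps / 2 * Sum n (fun i => (/ 2) ^ S i) <= eps / 2 * 1)
      by (apply Rmult_le_compat_l; lra).
    lra.
Qed.

Definition cover_inf (E : X -> Prop) : Rbar :=
  Rbar_inf (fun v => exists c, (forall n, valid (c n)) /\
    (forall x, E x -> exists n, mem (c n) x) /\ v = series_Rbar (fun n => vol (c n))).

Lemma cover_inf_le (E : X -> Prop) s :
  mle E s -> exists m, cover_inf E = Fin m /\ mle E m /\ m <= s.
Proof.
intros H; unfold cover_inf.
match goal with |- context [Rbar_inf ?Q] => set (P := Q) end.
assert (HP0 : forall x, P x -> Rbar_le (Fin 0) x).
{ intros x [c [V [_ ->]]].
  destruct (series_Rbar (fun n => vol (c n))) as [r| |] eqn:Er; simpl; auto.
  - assert (Hr := proj1 (series_Rbar_le (fun n => vol (c n)) r)).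
    rewrite Er in Hr; specialize (Hr (Rbar_le_refl _) O); simpl in Hr.
    specialize (vol_ge0 _ (V O)); lra.
  - assert (Hr := proj1 (series_Rbar_le (fun n => vol (c n)) (-1))).
    rewrite Er in Hr; specialize (Hr I O); simpl in Hr.
    specialize (vol_ge0 _ (V O)); lra. }
assert (Happ : forall t, mle E t -> forall eps, eps > 0 -> exists r, P (Fin r) /\ r <= t + eps).
{ intros t Ht eps Heps; destruct (Ht eps Heps) as [c [V [C Sc]]].
  assert (Hle : Rbar_le (series_Rbar (fun n => vol (c n))) (Fin (t + eps))).
  { apply series_Rbar_le; intros n; rewrite sum_f_R0_Sum; auto. }
  assert (HPs : P (series_Rbar (fun n => vol (c n)))) by (exists c; auto).
  specialize (HP0 _ HPs).
  destruct (series_Rbar (fun n => vol (c n))) as [r| |]; simpl in *; try tauto.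
  exists r; auto. }
destruct (Rbar_inf_Fin P 0) as [m [Em [_ [H1 H2]]]]; auto.
- destruct (Happ _ H 1 ltac:(lra)) as [r [Hr _]]; eauto.
- exists m; split; [auto|split].
  + apply mle_lim; intros eps Heps.
    destruct (classic (exists r, P (Fin r) /\ r <= m + eps)) as [[r [[c [V [C Hr]]] Hrm]]|Hn].
    * intros e He; exists c; split; [auto|split; [auto|]].
      intros [|n]; [simpl; assert (Hr0 : Rbar_le (Fin 0) (Fin r)) by (apply HP0; exists c; auto);
        simpl in Hr0; lra|].
      rewrite <- sum_f_R0_Sum.
      assert (Hle := proj1 (series_Rbar_le (fun n => vol (c n)) r)).
      rewrite <- Hr in Hle; specialize (Hle (Rbar_le_refl _) n); lra.
    * exfalso; assert (m + eps <= m); [|lra].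
      apply H2; intros [x| |] Hx; simpl; auto.
      -- apply Rnot_lt_le; intros Hlt; apply Hn; exists x; split; [auto|lra].
      -- exact (HP0 _ Hx).
  + apply Rnot_lt_le; intros Hlt.
    destruct (Happ _ H ((m - s) / 2) ltac:(lra)) as [r [Hr Hrs]].
    specialize (H1 r Hr); lra.
Qed.

Lemma cover_inf_Fin (E : X -> Prop) m :
  cover_inf E = Fin m -> mle E m /\ forall s, mle E s -> m <= s.
Proof.
intros Hm.
(* A finite infimum forces some cover of finite volume, since otherwise [PInf] would be a lower
   bound. *)
assert (Hle : exists s, mle E s).
{ apply NNPP; intros Hn.
  destruct (Rbar_inf_spec (fun v => exists c, (forall n, valid (c n)) /\
    (forall x, E x -> exists n, mem (c n) x) /\ v = series_Rbar (fun n => vol (c n)))) as [_ H2].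
  fold (cover_inf E) in H2; rewrite Hm in H2.
  specialize (H2 PInf); simpl in H2; apply H2.
  intros x [c [V [C ->]]].
  destruct (series_Rbar _) as [r| |] eqn:Er; auto; apply Hn.
  - exists r; intros eps Heps; exists c; split; [auto|split; [auto|]].
    assert (Hr := proj1 (series_Rbar_le (fun n => vol (c n)) r)).
    rewrite Er in Hr; specialize (Hr (Rbar_le_refl _)).
    intros n; apply Rle_trans with (Sum (S n) (fun i => vol (c i))).
    + apply Sum_incr; auto.
    + rewrite <- sum_f_R0_Sum; specialize (Hr n); lra.
  - exfalso; assert (Hr := proj1 (series_Rbar_le (fun n => vol (c n)) (-1))).
    rewrite Er in Hr; specialize (Hr I O); simpl in Hr.
    specialize (vol_ge0 _ (V O)); lra. }
destruct Hle as [s0 Hs0]; split.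
- destruct (cover_inf_le _ _ Hs0) as [m' [E' [H' _]]].
  rewrite Hm in E'; injection E' as <-; auto.
- intros s Hs; destruct (cover_inf_le _ _ Hs) as [m' [E' [_ H']]].
  assert (m = m') by congruence; lra.
Qed.

End Cover.

(** * Lebesgue outer measure on the line and in the plane *)

Definition box1 : Type := R * R.
Definition valid1 (j : box1) : Prop := fst j <= snd j.
Definition mem1 (j : box1) (x : R) : Prop := fst j <= x <= snd j.
Definition vol1 (j : box1) : R := snd j - fst j.
Definition mle1 : (R -> Prop) -> R -> Prop := mle R box1 valid1 mem1 vol1.

Definition box2 : Type := box1 * box1.
Definition valid2 (j : box2) : Prop := valid1 (fst j) /\ valid1 (snd j).
Definition mem2 (j : box2) (p : R * R) : Prop := mem1 (fst j) (fst p) /\ mem1 (snd j) (snd p).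
Definition vol2 (j : box2) : R := vol1 (fst j) * vol1 (snd j).
Definition mle2 (E : R -> R -> Prop) : R -> Prop :=
  mle (R * R) box2 valid2 mem2 vol2 (fun p => E (fst p) (snd p)).

Definition o1 : box1 := (0, 0).
Definition o2 : box2 := (o1, o1).

Lemma vol1_ge0 j : valid1 j -> 0 <= vol1 j.
Proof. unfold valid1, vol1; lra. Qed.

Lemma vol2_ge0 j : valid2 j -> 0 <= vol2 j.
Proof. intros [H1 H2]; apply Rmult_le_pos; apply vol1_ge0; auto. Qed.

Lemma valid1_o : valid1 o1.
Proof. unfold valid1; simpl; lra. Qed.

Lemma valid2_o : valid2 o2.
Proof. split; apply valid1_o. Qed.

Lemma vol1_o : vol1 o1 = 0.
Proof. unfold vol1; simpl; ring. Qed.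

Lemma vol2_o : vol2 o2 = 0.
Proof. unfold vol2; simpl; rewrite vol1_o; ring. Qed.

Lemma pred_ext {X : Type} (P Q : X -> Prop) : (forall x, P x <-> Q x) -> P = Q.
Proof.
intros H; apply functional_extensionality; intros x; apply propositional_extensionality; auto.
Qed.

Lemma lm1_cover_inf (E : R -> Prop) : lm1 E = cover_inf R box1 valid1 mem1 vol1 E.
Proof.
unfold lm1, cover_inf; f_equal; apply pred_ext; intros v; split.
- intros [a [b [H1 [H2 H3]]]]; exists (fun n => (a n, b n)); auto.
- intros [c [H1 [H2 H3]]]; exists (fun n => fst (c n)), (fun n => snd (c n)); auto.
Qed.

Lemma lm2_cover_inf (E : R -> R -> Prop) :
  lm2 E = cover_inf (R * R) box2 valid2 mem2 vol2 (fun p => E (fst p) (snd p)).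
Proof.
unfold lm2, cover_inf; f_equal; apply pred_ext; intros v; split.
- intros [a1 [b1 [a2 [b2 [H1 [H2 H3]]]]]]; exists (fun n => ((a1 n, b1 n), (a2 n, b2 n))).
  split; [auto|split; [|auto]].
  intros [x y] Hxy; exact (H2 x y Hxy).
- intros [c [H1 [H2 H3]]].
  exists (fun n => fst (fst (c n))), (fun n => snd (fst (c n))),
    (fun n => fst (snd (c n))), (fun n => snd (snd (c n))).
  split; [auto|split; [|auto]].
  intros x y Hxy; exact (H2 (x, y) Hxy).
Qed.

Lemma lm1_le E s : mle1 E s -> exists m, lm1 E = Fin m /\ mle1 E m /\ m <= s.
Proof. rewrite lm1_cover_inf; apply cover_inf_le; exact vol1_ge0. Qed.

Lemma lm1_Fin E m : lm1 E = Fin m -> mle1 E m /\ forall s, mle1 E s -> m <= s.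
Proof. rewrite lm1_cover_inf; apply cover_inf_Fin; exact vol1_ge0. Qed.

Lemma lm2_le E s : mle2 E s -> exists m, lm2 E = Fin m /\ mle2 E m /\ m <= s.
Proof. rewrite lm2_cover_inf; apply cover_inf_le; exact vol2_ge0. Qed.

Lemma lm2_Fin E m : lm2 E = Fin m -> mle2 E m /\ forall s, mle2 E s -> m <= s.
Proof. rewrite lm2_cover_inf; apply cover_inf_Fin; exact vol2_ge0. Qed.

Lemma mle1_mono E E' s s' : (forall x, E x -> E' x) -> s' <= s -> mle1 E' s' -> mle1 E s.
Proof. apply mle_mono. Qed.

Lemma mle2_mono (E E' : R -> R -> Prop) s s' :
  (forall x y, E x y -> E' x y) -> s' <= s -> mle2 E' s' -> mle2 E s.
Proof. intros H; apply mle_mono; intros p; apply H. Qed.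

Lemma mle1_ge0 E s : mle1 E s -> 0 <= s.
Proof. apply mle_ge0. Qed.

Lemma mle2_ge0 E s : mle2 E s -> 0 <= s.
Proof. apply mle_ge0. Qed.

Lemma mle1_empty (E : R -> Prop) : (forall x, ~ E x) -> mle1 E 0.
Proof. apply mle_empty with (1 := valid1_o) (2 := vol1_o). Qed.

Lemma mle2_empty (E : R -> R -> Prop) : (forall x y, ~ E x y) -> mle2 E 0.
Proof. intros H; apply mle_empty with (1 := valid2_o) (2 := vol2_o); intros p; apply H. Qed.

Lemma mle1_interval (E : R -> Prop) a b :
  a <= b -> (forall x, E x -> a <= x <= b) -> mle1 E (b - a).
Proof. exact (mle_one _ _ _ _ _ vol1_ge0 _ valid1_o vol1_o E (a, b)). Qed.

Lemma mle2_rectangle (E : R -> R -> Prop) a b c d :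
  a <= b -> c <= d -> (forall x y, E x y -> a <= x <= b /\ c <= y <= d) ->
  mle2 E ((b - a) * (d - c)).
Proof.
intros H1 H2 H.
apply (mle_one _ _ _ _ _ vol2_ge0 _ valid2_o vol2_o _ ((a, b), (c, d))).
- split; auto.
- intros p; apply H.
Qed.

Lemma mle1_union (E1 E2 : R -> Prop) s1 s2 :
  mle1 E1 s1 -> mle1 E2 s2 -> mle1 (fun x => E1 x \/ E2 x) (s1 + s2).
Proof. apply mle_union; exact vol1_ge0. Qed.

Lemma mle2_union (E1 E2 : R -> R -> Prop) s1 s2 :
  mle2 E1 s1 -> mle2 E2 s2 -> mle2 (fun x y => E1 x y \/ E2 x y) (s1 + s2).
Proof. apply (mle_union _ _ _ _ _ vol2_ge0 (fun p => E1 (fst p) (snd p))). Qed.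

Lemma mle1_finite n (E : nat -> R -> Prop) s :
  (forall i, (i < n)%nat -> mle1 (E i) (s i)) ->
  mle1 (fun x => exists i, (i < n)%nat /\ E i x) (Sum n s).
Proof. apply mle_finite with (1 := vol1_ge0) (2 := valid1_o) (3 := vol1_o). Qed.

Lemma mle2_finite n (E : nat -> R -> R -> Prop) s :
  (forall i, (i < n)%nat -> mle2 (E i) (s i)) ->
  mle2 (fun x y => exists i, (i < n)%nat /\ E i x y) (Sum n s).
Proof.
apply (mle_finite _ _ _ _ _ vol2_ge0 _ valid2_o vol2_o n (fun i p => E i (fst p) (snd p))).
Qed.

Lemma mle1_translate (E : R -> Prop) t s : mle1 E s -> mle1 (fun x => E (x + t)) s.
Proof.
apply (mle_map _ _ _ _ _ (fun x => x + t) (fun j : box1 => (fst j - t, snd j - t))).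
- intros [a b]; unfold valid1, vol1; simpl; split; lra.
- intros [a b] x _; unfold mem1; simpl; lra.
Qed.

Lemma mle2_translate (E : R -> R -> Prop) t t' s :
  mle2 E s -> mle2 (fun x y => E (x + t) (y + t')) s.
Proof.
apply (mle_map _ _ _ _ _ (fun p : R * R => (fst p + t, snd p + t'))
  (fun j : box2 => ((fst (fst j) - t, snd (fst j) - t), (fst (snd j) - t', snd (snd j) - t')))
  (fun p => E (fst p) (snd p))).
- intros [[a b] [c d]]; unfold valid2, valid1, vol2, vol1; simpl; split; [lra|ring].
- intros [[a b] [c d]] [x y] _; unfold mem2, mem1; simpl; lra.
Qed.

Lemma mle2_swap (E : R -> R -> Prop) s : mle2 E s -> mle2 (fun x y => E y x) s.
Proof.
apply (mle_map _ _ _ _ _ (fun p : R * R => (snd p, fst p)) (fun j : box2 => (snd j, fst j))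
  (fun p => E (fst p) (snd p))).
- intros [[a b] [c d]]; unfold valid2, valid1, vol2, vol1; simpl; split; [lra|ring].
- intros [[a b] [c d]] [x y] _; unfold mem2, mem1; simpl; lra.
Qed.

Lemma mle2_reflect (E : R -> R -> Prop) q s : mle2 E s -> mle2 (fun x y => E x (q - y)) s.
Proof.
apply (mle_map _ _ _ _ _ (fun p : R * R => (fst p, q - snd p))
  (fun j : box2 => (fst j, (q - snd (snd j), q - fst (snd j))))
  (fun p => E (fst p) (snd p))).
- intros [[a b] [c d]]; unfold valid2, valid1, vol2, vol1; simpl; split; [lra|ring].
- intros [[a b] [c d]] [x y] _; unfold mem2, mem1; simpl; lra.
Qed.

Definition cut_below (c : R) (j : box1) : box1 := (Rmin (fst j) c, Rmin (snd j) c).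
Definition cut_above (c : R) (j : box1) : box1 := (Rmax (fst j) c, Rmax (snd j) c).

Lemma cut_spec c j : valid1 j ->
  valid1 (cut_below c j) /\ valid1 (cut_above c j) /\
  vol1 (cut_below c j) + vol1 (cut_above c j) = vol1 j.
Proof.
destruct j as [a b]; unfold valid1, vol1, cut_below, cut_above, Rmin, Rmax; simpl; intros H.
destruct (Rle_dec a c), (Rle_dec b c); lra.
Qed.

Lemma cut_below_mem c j x : x <= c -> mem1 j x -> mem1 (cut_below c j) x.
Proof.
destruct j as [a b]; unfold mem1, cut_below, Rmin; simpl.
destruct (Rle_dec a c), (Rle_dec b c); lra.
Qed.

Lemma cut_above_mem c j x : c <= x -> mem1 j x -> mem1 (cut_above c j) x.
Proof.
destruct j as [a b]; unfold mem1, cut_above, Rmax; simpl.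
destruct (Rle_dec a c), (Rle_dec b c); lra.
Qed.

Lemma mle1_split (E E1 E2 : R -> Prop) c s :
  (forall x, E1 x -> E x /\ x <= c) -> (forall x, E2 x -> E x /\ c <= x) ->
  mle1 E s -> exists s1 s2, mle1 E1 s1 /\ mle1 E2 s2 /\ s1 + s2 <= s.
Proof.
intros H1 H2.
apply (mle_split _ _ _ _ _ vol1_ge0 _ valid1_o (cut_below c) (cut_above c)).
- intros j; apply cut_spec.
- intros j x _ Hx; destruct (H1 x Hx); split; auto; apply cut_below_mem; auto.
- intros j x _ Hx; destruct (H2 x Hx); split; auto; apply cut_above_mem; auto.
Qed.

Lemma mle2_split_x (E E1 E2 : R -> R -> Prop) c s :
  (forall x y, E1 x y -> E x y /\ x <= c) -> (forall x y, E2 x y -> E x y /\ c <= x) ->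
  mle2 E s -> exists s1 s2, mle2 E1 s1 /\ mle2 E2 s2 /\ s1 + s2 <= s.
Proof.
intros H1 H2.
apply (mle_split _ _ _ _ _ vol2_ge0 _ valid2_o
  (fun j => (cut_below c (fst j), snd j)) (fun j => (cut_above c (fst j), snd j))).
- intros [j k] [V1 V2]; destruct (cut_spec c j V1) as [C1 [C2 C3]].
  unfold valid2, vol2; simpl in *; rewrite <- C3; repeat split; auto; ring.
- intros [j k] [x y] _ Hx; destruct (H1 _ _ Hx); split; auto.
  intros [M1 M2]; split; auto; apply cut_below_mem; auto.
- intros [j k] [x y] _ Hx; destruct (H2 _ _ Hx); split; auto.
  intros [M1 M2]; split; auto; apply cut_above_mem; auto.
Qed.

Lemma mle2_split_y (E E1 E2 : R -> R -> Prop) c s :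
  (forall x y, E1 x y -> E x y /\ y <= c) -> (forall x y, E2 x y -> E x y /\ c <= y) ->
  mle2 E s -> exists s1 s2, mle2 E1 s1 /\ mle2 E2 s2 /\ s1 + s2 <= s.
Proof.
intros H1 H2 H.
destruct (mle2_split_x (fun x y => E y x) (fun x y => E1 y x) (fun x y => E2 y x) c s)
  as [s1 [s2 [S1 [S2 S3]]]]; auto.
- apply mle2_swap; auto.
- exists s1, s2; split; [|split; auto]; [exact (mle2_swap _ _ S1)|exact (mle2_swap _ _ S2)].
Qed.

(** * Cousin's lemma, lower bounds and compactness *)

(** The supremum of the points reachable from [a] can be passed by the local hypothesis at that
    supremum. This interval induction plays the role of the Heine-Borel theorem below. *)
Lemma Cousin1 (P : R -> R -> Prop) :
  (forall a b c, a <= b <= c -> P a b -> P b c -> P a c) ->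
  (forall x, exists d, d > 0 /\ forall a b, a <= x <= b -> b - a < d -> P a b) ->
  forall a b, a <= b -> P a b.
Proof.
intros Hglue Hloc a b Hab.
destruct (completeness (fun x => a <= x <= b /\ P a x)) as [s [Hs1 Hs2]].
- exists b; intros x [Hx _]; lra.
- exists a; split; [lra|]; destruct (Hloc a) as [d [Hd H]]; apply H; lra.
- assert (Has : a <= s).
  { apply Hs1; split; [lra|]; destruct (Hloc a) as [d [Hd H]]; apply H; lra. }
  assert (Hsb : s <= b) by (apply Hs2; intros x [Hx _]; lra).
  destruct (Hloc s) as [d [Hd H]].
  assert (Hx : exists x, a <= x <= b /\ P a x /\ s - d / 2 < x).
  { apply NNPP; intros Hn; assert (s <= s - d / 2); [|lra].
    apply Hs2; intros x [Hx HP]; apply Rnot_lt_le; intros Hlt; apply Hn; eauto. }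
  destruct Hx as [x [Hx [HP Hxs]]].
  assert (Hxs' : x <= s) by (apply Hs1; auto).
  assert (Hext : forall s', s <= s' <= b -> s' <= s + d / 3 -> P a s').
  { intros s' H1 H2; apply Hglue with x; [lra|auto|apply H; lra]. }
  destruct (Rle_dec b (s + d / 3)) as [Hb|Hb]; [apply Hext; lra|].
  assert (s + d / 3 <= s); [|lra].
  apply Hs1; split; [lra|]; apply Hext; lra.
Qed.

Lemma Cousin2 (P : R -> R -> R -> R -> Prop) :
  (forall a b c y1 y2, a <= b <= c -> y1 <= y2 -> P a b y1 y2 -> P b c y1 y2 -> P a c y1 y2) ->
  (forall x1 x2 a b c, x1 <= x2 -> a <= b <= c -> P x1 x2 a b -> P x1 x2 b c -> P x1 x2 a c) ->
  (forall x y, exists d, d > 0 /\ forall a b a' b', a <= x <= b -> b - a < d ->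
     a' <= y <= b' -> b' - a' < d -> P a b a' b') ->
  forall a b a' b', a <= b -> a' <= b' -> P a b a' b'.
Proof.
intros Hx Hy Hloc a b a' b' Hab Hab'; revert a b Hab.
apply Cousin1; [intros a b c H; apply Hx; auto|].
intros x; revert a' b' Hab'.
(* The induction in the second coordinate provides one width [d] that serves thin strips around [x]
   over the whole of [a', b']. *)
apply (Cousin1 (fun a' b' => exists d, d > 0 /\ forall a b, a <= x <= b -> b - a < d -> P a b a' b')).
- intros a b c Habc [d1 [Hd1 H1]] [d2 [Hd2 H2]].
  exists (Rmin d1 d2); split; [apply Rmin_glb_lt; auto|].
  intros u v Hu Huv; apply Hy with b; [lra|auto|apply H1|apply H2]; auto.
  + apply Rlt_le_trans with (1 := Huv), Rmin_l.
  + apply Rlt_le_trans with (1 := Huv), Rmin_r.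
- intros y; destruct (Hloc x y) as [d [Hd H]]; exists d; split; auto.
  intros u v Hu Huv; exists d; split; auto.
Qed.

(* [clamp j y - clamp j x] is the length of the intersection of [j] with [x, y]. *)
Definition clamp (j : box1) (t : R) : R := Rmax (fst j) (Rmin t (snd j)).

Lemma clamp_incr j x y : x <= y -> clamp j x <= clamp j y.
Proof.
intros H; unfold clamp; apply Rle_max_compat_l; unfold Rmin.
destruct (Rle_dec x (snd j)), (Rle_dec y (snd j)); lra.
Qed.

Lemma clamp_range j t : valid1 j -> fst j <= clamp j t <= snd j.
Proof.
unfold valid1, clamp, Rmax, Rmin; intros H.
destruct (Rle_dec t (snd j)); destruct (Rle_dec (fst j) _); lra.
Qed.

Lemma clamp_id j t : mem1 j t -> clamp j t = t.
Proof.
unfold mem1, clamp, Rmax, Rmin; intros H.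
destruct (Rle_dec t (snd j)); destruct (Rle_dec (fst j) _); lra.
Qed.

Definition omem1 (j : box1) (x : R) : Prop := fst j < x < snd j.
Definition omem2 (j : box2) (p : R * R) : Prop := omem1 (fst j) (fst p) /\ omem1 (snd j) (snd p).

Lemma enlarge1 j e : valid1 j -> e > 0 -> exists j', valid1 j' /\ vol1 j' <= vol1 j + e /\
  forall x, mem1 j x -> omem1 j' x.
Proof.
destruct j as [a b]; intros Hj He; exists (a - e / 2, b + e / 2).
unfold valid1, vol1, mem1, omem1 in *; simpl in *; repeat split; try lra.
Qed.

Lemma enlarge2 j e : valid2 j -> e > 0 -> exists j', valid2 j' /\ vol2 j' <= vol2 j + e /\
  forall x, mem2 j x -> omem2 j' x.
Proof.
destruct j as [[a b] [c d]]; intros [H1 H2] He; unfold valid1 in *; simpl in *.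
set (w := b - a + (d - c) + 1).
assert (Hw : w >= 1) by (unfold w; lra).
set (t := Rmin 1 (e / w)).
assert (Ht0 : t > 0) by (apply Rmin_glb_lt; [lra|apply Rdiv_lt_0_compat; lra]).
assert (Ht1 : t <= 1) by apply Rmin_l.
assert (Htw : t * w <= e).
{ apply Rle_trans with (e / w * w); [apply Rmult_le_compat_r; [lra|apply Rmin_r]|].
  right; field; lra. }
exists ((a - t / 2, b + t / 2), (c - t / 2, d + t / 2)).
unfold valid2, valid1, vol2, vol1, mem2, omem2, mem1, omem1 in *; simpl in *.
repeat split; try lra.
unfold w in Htw.
replace ((b + t / 2 - (a - t / 2)) * (d + t / 2 - (c - t / 2)))
  with ((b - a) * (d - c) + t * (b - a + (d - c)) + t * t) by field.
assert (t * t <= t * 1) by (apply Rmult_le_compat_l; lra). lra.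
Qed.

Lemma omem1_near j x : omem1 j x -> exists d, d > 0 /\
  forall a b, a <= x <= b -> b - a < d -> forall t, a <= t <= b -> mem1 j t.
Proof.
destruct j as [p q]; unfold omem1, mem1; simpl; intros H.
exists (Rmin (x - p) (q - x)); split; [apply Rmin_glb_lt; lra|].
intros a b Hx Hab t Ht.
assert (H1 := Rmin_l (x - p) (q - x)); assert (H2 := Rmin_r (x - p) (q - x)); lra.
Qed.

(** The lengths of the traces of the covering intervals on [x, y] add when intervals are glued, and
    near a point one open interval of the cover suffices. So [Cousin1] bounds [b - a] by a finite
    sum of traces. *)
Lemma mle1_ge_closed (E : R -> Prop) a b s :
  a <= b -> (forall x, a <= x <= b -> E x) -> mle1 E s -> b - a <= s.
Proof.
intros Hab HE H.
apply Rnot_lt_le; intros Hlt.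
destruct (mle_open_cover _ _ _ _ _ omem1 E s ((b - a - s) / 2) enlarge1 H) as [c [V [C Sc]]]; [lra|].
assert (Key : forall x y, x <= y -> a <= x -> y <= b ->
  exists N, y - x <= Sum N (fun n => clamp (c n) y - clamp (c n) x)).
{ apply (Cousin1 (fun x y => a <= x -> y <= b ->
    exists N, y - x <= Sum N (fun n => clamp (c n) y - clamp (c n) x))).
  - intros x y z Hxyz H1 H2 Hx Hz.
    destruct (H1 ltac:(lra) ltac:(lra)) as [N1 HN1], (H2 ltac:(lra) ltac:(lra)) as [N2 HN2].
    exists (max N1 N2).
    rewrite (Sum_ext _ _ (fun n => (clamp (c n) y - clamp (c n) x) + (clamp (c n) z - clamp (c n) y)))
      by (intros; ring).
    rewrite Sum_plus.
    assert (M1 := Sum_incr N1 (max N1 N2) (fun n => clamp (c n) y - clamp (c n) x) ltac:(lia)).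
    assert (M2 := Sum_incr N2 (max N1 N2) (fun n => clamp (c n) z - clamp (c n) y) ltac:(lia)).
    assert (G1 : forall i, clamp (c i) x <= clamp (c i) y) by (intros; apply clamp_incr; lra).
    assert (G2 : forall i, clamp (c i) y <= clamp (c i) z) by (intros; apply clamp_incr; lra).
    specialize (M1 ltac:(intros i; specialize (G1 i); lra)).
    specialize (M2 ltac:(intros i; specialize (G2 i); lra)). lra.
  - intros x; destruct (classic (a <= x <= b)) as [Hx|Hx].
    + destruct (C x (HE x Hx)) as [n Hn].
      destruct (omem1_near _ _ Hn) as [d [Hd Hd']]; exists d; split; auto.
      intros u v Huv Hl _ _; exists (S n).
      apply Rle_trans with (clamp (c n) v - clamp (c n) u).
      * rewrite !clamp_id; [lra| |]; apply (Hd' u v); lra.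
      * apply (Sum_term_le (S n) (fun n => clamp (c n) v - clamp (c n) u)); [lia|].
        intros i; assert (clamp (c i) u <= clamp (c i) v) by (apply clamp_incr; lra); lra.
    + exists 1; split; [lra|]; intros u v Huv _ H1 H2; exfalso; apply Hx; lra. }
destruct (Key a b) as [N HN]; try lra.
assert (Sum N (fun n => clamp (c n) b - clamp (c n) a) <= Sum N (fun n => vol1 (c n))).
{ apply Sum_le; intros i _; assert (H1 := clamp_range (c i) a (V i)).
  assert (H2 := clamp_range (c i) b (V i)); unfold vol1; lra. }
specialize (Sc N); lra.
Qed.

Lemma mle2_ge_closed (E : R -> R -> Prop) x1 x2 y1 y2 s :
  x1 <= x2 -> y1 <= y2 -> (forall x y, x1 <= x <= x2 -> y1 <= y <= y2 -> E x y) ->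
  mle2 E s -> (x2 - x1) * (y2 - y1) <= s.
Proof.
intros Hx Hy HE H.
apply Rnot_lt_le; intros Hlt.
destruct (mle_open_cover _ _ _ _ _ omem2 _ s (((x2 - x1) * (y2 - y1) - s) / 2) enlarge2 H)
  as [c [V [C Sc]]]; [lra|].
set (part := fun a b a' b' n =>
  (clamp (fst (c n)) b - clamp (fst (c n)) a) * (clamp (snd (c n)) b' - clamp (snd (c n)) a')).
assert (part_ge0 : forall a b a' b' n, a <= b -> a' <= b' -> 0 <= part a b a' b' n).
{ intros; apply Rmult_le_pos.
  - assert (clamp (fst (c n)) a <= clamp (fst (c n)) b) by (apply clamp_incr; auto); lra.
  - assert (clamp (snd (c n)) a' <= clamp (snd (c n)) b') by (apply clamp_incr; auto); lra. }
assert (Key : forall a b a' b', a <= b -> a' <= b' -> x1 <= a -> b <= x2 -> y1 <= a' -> b' <= y2 ->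
  exists N, (b - a) * (b' - a') <= Sum N (part a b a' b')).
{ apply (Cousin2 (fun a b a' b' => x1 <= a -> b <= x2 -> y1 <= a' -> b' <= y2 ->
    exists N, (b - a) * (b' - a') <= Sum N (part a b a' b'))).
  - intros a b d a' b' Habd Hab' H1 H2 Ha Hd Ha' Hb'.
    destruct (H1 ltac:(lra) ltac:(lra) ltac:(lra) ltac:(lra)) as [N1 HN1].
    destruct (H2 ltac:(lra) ltac:(lra) ltac:(lra) ltac:(lra)) as [N2 HN2].
    exists (max N1 N2).
    rewrite (Sum_ext _ _ (fun n => part a b a' b' n + part b d a' b' n))
      by (intros; unfold part; ring).
    rewrite Sum_plus.
    assert (M1 := Sum_incr N1 (max N1 N2) (part a b a' b') ltac:(lia)).
    assert (M2 := Sum_incr N2 (max N1 N2) (part b d a' b') ltac:(lia)).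
    specialize (M1 ltac:(intros i; apply part_ge0; lra)).
    specialize (M2 ltac:(intros i; apply part_ge0; lra)). lra.
  - intros a b a' b' d' Hab Habd H1 H2 Ha Hd Ha' Hb'.
    destruct (H1 ltac:(lra) ltac:(lra) ltac:(lra) ltac:(lra)) as [N1 HN1].
    destruct (H2 ltac:(lra) ltac:(lra) ltac:(lra) ltac:(lra)) as [N2 HN2].
    exists (max N1 N2).
    rewrite (Sum_ext _ _ (fun n => part a b a' b' n + part a b b' d' n))
      by (intros; unfold part; ring).
    rewrite Sum_plus.
    assert (M1 := Sum_incr N1 (max N1 N2) (part a b a' b') ltac:(lia)).
    assert (M2 := Sum_incr N2 (max N1 N2) (part a b b' d') ltac:(lia)).
    specialize (M1 ltac:(intros i; apply part_ge0; lra)).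
    specialize (M2 ltac:(intros i; apply part_ge0; lra)). lra.
  - intros x y; destruct (classic (x1 <= x <= x2 /\ y1 <= y <= y2)) as [[Hx' Hy']|Hn].
    + destruct (C (x, y) (HE x y Hx' Hy')) as [n [Hn1 Hn2]].
      destruct (omem1_near _ _ Hn1) as [d1 [Hd1 Hd1']].
      destruct (omem1_near _ _ Hn2) as [d2 [Hd2 Hd2']].
      exists (Rmin d1 d2); split; [apply Rmin_glb_lt; auto|].
      assert (L1 := Rmin_l d1 d2); assert (L2 := Rmin_r d1 d2).
      intros a b a' b' Hab Hl Hab' Hl' _ _ _ _; exists (S n).
      apply Rle_trans with (part a b a' b' n).
      * unfold part; rewrite !clamp_id; [lra| | | |];
          (apply (Hd1' a b); simpl; lra) || (apply (Hd2' a' b'); simpl; lra).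
      * apply Sum_term_le; [lia|]; intros i; apply part_ge0; lra.
    + exists 1; split; [lra|]; intros; exfalso; apply Hn; lra. }
destruct (Key x1 x2 y1 y2) as [N HN]; try lra.
assert (Sum N (part x1 x2 y1 y2) <= Sum N (fun n => vol2 (c n))).
{ apply Sum_le; intros i _; destruct (V i) as [V1 V2].
  assert (H1 := clamp_range (fst (c i)) x1 V1); assert (H2 := clamp_range (fst (c i)) x2 V1).
  assert (H3 := clamp_range (snd (c i)) y1 V2); assert (H4 := clamp_range (snd (c i)) y2 V2).
  unfold part, vol2, vol1; apply Rmult_le_compat; try lra.
  - assert (clamp (fst (c i)) x1 <= clamp (fst (c i)) x2) by (apply clamp_incr; auto); lra.
  - assert (clamp (snd (c i)) y1 <= clamp (snd (c i)) y2) by (apply clamp_incr; auto); lra. }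
specialize (Sc N); lra.
Qed.

Lemma mle1_ge (E : R -> Prop) a b s :
  (forall x, a < x < b -> E x) -> mle1 E s -> b - a <= s.
Proof.
intros HE H; apply Rnot_lt_le; intros Hlt.
assert (Hs := mle1_ge0 _ _ H).
set (e := (b - a - s) / 4).
assert (He : e > 0) by (unfold e; lra).
assert (b - e - (a + e) <= s); [|unfold e in *; lra].
apply mle1_ge_closed with E; auto; [unfold e; lra|].
intros x Hx; apply HE; lra.
Qed.

Lemma mle2_ge (E : R -> R -> Prop) x1 x2 y1 y2 s :
  x1 <= x2 -> y1 <= y2 -> (forall x y, x1 < x < x2 -> y1 < y < y2 -> E x y) ->
  mle2 E s -> (x2 - x1) * (y2 - y1) <= s.
Proof.
intros Hx Hy HE H; apply Rnot_lt_le; intros Hlt.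
assert (Hs := mle2_ge0 _ _ H).
destruct (Req_dec x1 x2) as [->|Nx]; [rewrite Rminus_diag in Hlt; lra|].
destruct (Req_dec y1 y2) as [->|Ny]; [rewrite Rminus_diag in Hlt; lra|].
set (w := x2 - x1) in *; set (h := y2 - y1) in *.
assert (Hw : 0 < w) by (unfold w; lra); assert (Hh : 0 < h) by (unfold h; lra).
(* Shrinking each side by the factor 1 - 2k loses at most 4k w h, which is half of the excess
   [w * h - s]. *)
set (k := (w * h - s) / (w * h) / 8).
assert (Hwh : 0 < w * h) by (apply Rmult_lt_0_compat; auto).
assert (Hk : 0 < k <= / 8).
{ unfold k; split.
  - repeat apply Rdiv_lt_0_compat; lra.
  - assert ((w * h - s) / (w * h) <= 1); [|lra].
    apply Rmult_le_reg_r with (w * h); [auto|]; unfold Rdiv; rewrite Rmult_assoc, Rinv_l; lra. }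
assert (Hkw : 0 < k * w <= w / 8).
{ split; [apply Rmult_lt_0_compat; lra|]; assert (k * w <= / 8 * w) by (apply Rmult_le_compat_r; lra); lra. }
assert (Hkh : 0 < k * h <= h / 8).
{ split; [apply Rmult_lt_0_compat; lra|]; assert (k * h <= / 8 * h) by (apply Rmult_le_compat_r; lra); lra. }
assert (B : (x2 - k * w - (x1 + k * w)) * (y2 - k * h - (y1 + k * h)) <= s).
{ apply mle2_ge_closed with E; auto; try (unfold w, h in *; lra).
  intros x y H1 H2; apply HE; lra. }
replace ((x2 - k * w - (x1 + k * w)) * (y2 - k * h - (y1 + k * h)))
  with (w * h - 4 * (k * (w * h)) + 4 * (k * w * (k * h))) in B by (unfold w, h; ring).
assert (k * (w * h) = (w * h - s) / 8) by (unfold k; field; lra).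
assert (0 < k * w * (k * h)) by (apply Rmult_lt_0_compat; lra).
lra.
Qed.

(** With finitely many boxes, the rows and columns of [A] are dominated by step functions, which
    reduces the rearrangement to sorting a finite list. *)
Lemma compact_finite_cover (A : R -> R -> Prop) s eps :
  compact2 A -> mle2 A s -> eps > 0 ->
  exists (c : nat -> box2) (m : nat), (forall n, valid2 (c n)) /\
    (forall x y, A x y -> exists n, (n < m)%nat /\ mem2 (c n) (x, y)) /\
    Sum m (fun n => vol2 (c n)) <= s + eps.
Proof.
intros [Hcl [M HM]] H Heps.
destruct (mle_open_cover _ _ _ _ _ omem2 _ s eps enlarge2 H Heps) as [c [V [C Sc]]].
assert (Key : exists N, forall x y, - Rabs M <= x <= Rabs M -> - Rabs M <= y <= Rabs M ->
  A x y -> exists n, (n < N)%nat /\ mem2 (c n) (x, y)).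
{ assert (HM0 := Rabs_pos M).
  apply (Cousin2 (fun a b a' b' => exists N, forall x y, a <= x <= b -> a' <= y <= b' ->
    A x y -> exists n, (n < N)%nat /\ mem2 (c n) (x, y))); try lra.
  - intros a b d y1 y2 _ _ [N1 H1] [N2 H2]; exists (max N1 N2); intros x y Hx Hy HA.
    destruct (Rle_dec x b).
    + destruct (H1 x y ltac:(lra) Hy HA) as [k [Hk Hm]]; exists k; split; [lia|auto].
    + destruct (H2 x y ltac:(lra) Hy HA) as [k [Hk Hm]]; exists k; split; [lia|auto].
  - intros y1 y2 a b d _ _ [N1 H1] [N2 H2]; exists (max N1 N2); intros x y Hx Hy HA.
    destruct (Rle_dec y b).
    + destruct (H1 x y Hx ltac:(lra) HA) as [k [Hk Hm]]; exists k; split; [lia|auto].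
    + destruct (H2 x y Hx ltac:(lra) HA) as [k [Hk Hm]]; exists k; split; [lia|auto].
  - intros x y; destruct (classic (A x y)) as [HA|HA].
    + destruct (C (x, y) HA) as [n [Hn1 Hn2]].
      destruct (omem1_near _ _ Hn1) as [d1 [Hd1 Hd1']].
      destruct (omem1_near _ _ Hn2) as [d2 [Hd2 Hd2']].
      exists (Rmin d1 d2); split; [apply Rmin_glb_lt; auto|].
      assert (L1 := Rmin_l d1 d2); assert (L2 := Rmin_r d1 d2).
      intros a b a' b' Hab Hl Hab' Hl'; exists (S n).
      intros u v Hu Hv _; exists n; split; [lia|]; split; simpl.
      * apply (Hd1' a b); auto; lra.
      * apply (Hd2' a' b'); auto; lra.
    + assert (Hd : exists d, d > 0 /\ forall u v, A u v -> ~ (Rabs (u - x) < d /\ Rabs (v - y) < d)).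
      { apply NNPP; intros Hn; apply HA, Hcl; intros d Hd; apply NNPP; intros Hn'.
        apply Hn; exists d; split; auto; intros u v HA' [H1 H2]; apply Hn'; eauto. }
      destruct Hd as [d [Hd Hd']]; exists d; split; auto.
      intros a b a' b' Hab Hl Hab' Hl'; exists O; intros u v Hu Hv HA'.
      exfalso; apply (Hd' u v HA'); split; apply Rabs_def1; lra. }
destruct Key as [N HN]; exists c, N; split; [auto|split; [|auto]].
intros x y HA; destruct (HM x y HA) as [H1 H2]; assert (H3 := Rle_abs M).
assert (H4 := Rle_abs (- x)); assert (H5 := Rle_abs (- y)); rewrite Rabs_Ropp in H4, H5.
assert (H6 := Rle_abs x); assert (H7 := Rle_abs y); apply HN; auto; lra.
Qed.

(** * Profiles and their integrals *)

Definition subgraph (f : R -> R) (x y : R) : Prop := 0 <= x /\ 0 <= y /\ y < f x.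

Lemma integral0_le f s : mle2 (subgraph f) s -> exists i, integral0 f = Fin i /\ i <= s.
Proof. intros H; destruct (lm2_le _ _ H) as [m [H1 [_ H2]]]; eauto. Qed.

Lemma integral0_Fin f i :
  integral0 f = Fin i -> mle2 (subgraph f) i /\ forall s, mle2 (subgraph f) s -> i <= s.
Proof. apply lm2_Fin. Qed.

Lemma profile_zero : profile (fun _ => 0).
Proof.
split; [intros; lra|split; [intros; lra|split]].
- intros x Hx eps Heps; exists 1; split; [lra|]; intros; rewrite Rminus_diag, Rabs_R0; auto.
- exists 0; auto.
Qed.

Lemma integral0_zero : integral0 (fun _ => 0) = Fin 0.
Proof.
destruct (integral0_le (fun _ => 0) 0) as [i [Hi Hi0]].
- apply mle2_empty; intros x y [_ [Hy Hy']]; lra.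
- rewrite Hi; apply integral0_Fin in Hi; destruct Hi as [Hi _]; apply mle2_ge0 in Hi.
  f_equal; lra.
Qed.

Lemma profile_indicator c w : 0 <= w -> profile (fun p => if Rle_dec p c then w else 0).
Proof.
intros Hw; split; [|split; [|split]].
- intros x _; destruct (Rle_dec x c); lra.
- intros x y H; destruct (Rle_dec x c), (Rle_dec y c); lra.
- intros x Hx eps Heps; destruct (Rle_dec x c) as [Hc|Hc].
  + exists 1; split; [lra|]; intros y _ Hy; destruct (Rle_dec y c); [|lra].
    rewrite Rminus_diag, Rabs_R0; auto.
  + exists (x - c); split; [lra|]; intros y _ Hy; destruct (Rle_dec y c); [lra|].
    rewrite Rminus_diag, Rabs_R0; auto.
- exists (c + 1); intros x Hx; destruct (Rle_dec x c); lra.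
Qed.

Lemma profile_plus f g : profile f -> profile g -> profile (fun x => f x + g x).
Proof.
intros [F0 [F1 [F2 [M FM]]]] [G0 [G1 [G2 [N GN]]]]; split; [|split; [|split]].
- intros x Hx; specialize (F0 x Hx); specialize (G0 x Hx); lra.
- intros x y H; specialize (F1 x y H); specialize (G1 x y H); lra.
- intros x Hx eps Heps.
  destruct (F2 x Hx (eps / 2) ltac:(lra)) as [d1 [Hd1 H1]].
  destruct (G2 x Hx (eps / 2) ltac:(lra)) as [d2 [Hd2 H2]].
  assert (L1 := Rmin_l d1 d2); assert (L2 := Rmin_r d1 d2).
  exists (Rmin d1 d2); split; [apply Rmin_glb_lt; auto|].
  intros y Hy Hyx; specialize (H1 y Hy ltac:(lra)); specialize (H2 y Hy ltac:(lra)).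
  replace (f y + g y - (f x + g x)) with ((f y - f x) + (g y - g x)) by ring.
  apply Rle_lt_trans with (1 := Rabs_triang _ _); lra.
- exists (Rmax M N); intros x Hx; rewrite FM, GN; [ring| |].
  + apply Rle_trans with (2 := Hx), Rmax_r.
  + apply Rle_trans with (2 := Hx), Rmax_l.
Qed.

Lemma profile_Sum n (f : nat -> R -> R) :
  (forall i, (i < n)%nat -> profile (f i)) -> profile (fun x => Sum n (fun i => f i x)).
Proof.
induction n; intros H; simpl; [apply profile_zero|].
apply (profile_plus (fun x => Sum n (fun i => f i x))); auto.
Qed.

(** The value of [stepf] on cell [i] is such a tail: exactly the indicators with index at least [i]
    are active there. *)
Lemma Sum_tail_telescope n i (f : nat -> R) : (i <= n)%nat ->
  Sum n (fun k => if le_lt_dec i k then f k - f (S k) else 0) = f i - f n.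
Proof.
intros H; induction H.
- rewrite (Sum_ext _ _ (fun _ => 0)), Sum_const; [ring|].
  intros k Hk; destruct (le_lt_dec i k); [lia|auto].
- cbn [Sum]; rewrite IHle; destruct (le_lt_dec i m); [ring|lia].
Qed.

(** Cells are open on the left to match left-continuity; the alternative [i = O] takes in the point
    [p = 0]. *)
Lemma grid_cell_right N eta p : 0 <= p <= INR N * eta -> N <> O ->
  exists i, (i < N)%nat /\ (i = O \/ INR i * eta < p) /\ INR i * eta <= p <= INR (S i) * eta.
Proof.
induction N as [|n IH]; intros Hp Hn; [lia|].
destruct (Rle_dec p (INR n * eta)) as [H|H].
- destruct (Nat.eq_dec n 0) as [->|H'].
  + exists O; simpl in *; split; [lia|]; split; [auto|]; lra.
  + destruct IH as [i [Hi Hi']]; [lra|auto|]; exists i; split; [lia|auto].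
- exists n; split; [lia|]; split; [right; lra|]; lra.
Qed.

(* The left-continuous step function with value [F i] on the cell (i eta, (i+1) eta], written
   as a combination of indicators of initial segments so that it is visibly a profile. *)
Definition stepf (N : nat) (eta : R) (F : nat -> R) (p : R) : R :=
  Sum N (fun i => if Rle_dec p (INR (S i) * eta) then F i - F (S i) else 0).

Section Step.

Variables (N : nat) (eta : R) (F : nat -> R).
Hypothesis eta_gt0 : eta > 0.
Hypothesis F_decr : forall i, F (S i) <= F i.
Hypothesis F_N : F N = 0.

Lemma stepf_profile : profile (stepf N eta F).
Proof.
apply (profile_Sum N (fun i p => if Rle_dec p (INR (S i) * eta) then F i - F (S i) else 0)).
intros i _; apply profile_indicator; specialize (F_decr i); lra.
Qed.

Lemma stepf_ge i p : (i < N)%nat -> p <= INR (S i) * eta -> F i <= stepf N eta F p.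
Proof.
intros Hi Hp.
assert (E := Sum_tail_telescope N i F ltac:(lia)).
apply Rle_trans with (F i - F N); [rewrite F_N; lra|rewrite <- E].
apply Sum_le; intros k Hk; specialize (F_decr k).
destruct (le_lt_dec i k) as [H|H].
- destruct (Rle_dec p (INR (S k) * eta)) as [H'|H']; [lra|exfalso; apply H'].
  apply Rle_trans with (1 := Hp), Rmult_le_compat_r; [lra|apply le_INR; lia].
- destruct (Rle_dec p _); lra.
Qed.

Lemma stepf_le i p : (i <= N)%nat -> (i = O \/ INR i * eta < p) -> stepf N eta F p <= F i.
Proof.
intros Hi Hp.
assert (E := Sum_tail_telescope N i F ltac:(lia)).
apply Rle_trans with (F i - F N); [rewrite <- E|rewrite F_N; lra].
apply Sum_le; intros k Hk; specialize (F_decr k).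
destruct (le_lt_dec i k) as [H|H]; destruct (Rle_dec p _) as [H'|H']; try lra.
exfalso; destruct Hp as [->|Hp]; [lia|].
assert (INR (S k) * eta <= INR i * eta); [|lra].
apply Rmult_le_compat_r; [lra|apply le_INR; lia].
Qed.

Lemma stepf_integral : mle2 (subgraph (stepf N eta F)) (eta * Sum N F).
Proof.
assert (F_ge0 : forall i, (i <= N)%nat -> 0 <= F i).
{ assert (H : forall i m, (i <= m)%nat -> F m <= F i).
  { intros i m Hi; induction Hi as [|m _ IH]; [lra|]; specialize (F_decr m); lra. }
  intros i Hi; specialize (H i N Hi); lra. }
rewrite <- Sum_scal.
apply (mle2_mono _ (fun x y => exists i, (i < N)%nat /\
  (INR i * eta <= x <= INR (S i) * eta /\ 0 <= y <= F i))) with (2 := Rle_refl _).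
- intros p y [Hp [Hy Hyp]].
  destruct (Rle_dec p (INR N * eta)) as [HpN|HpN].
  + destruct (Nat.eq_dec N 0) as [E|E].
    * exfalso; unfold stepf in Hyp; rewrite E in Hyp; simpl in Hyp; lra.
    * destruct (grid_cell_right N eta p) as [i [Hi [Hi' Hi'']]]; [lra|auto|].
      exists i; split; [auto|split; [auto|]].
      assert (H := stepf_le i p ltac:(lia) Hi'); lra.
  + exfalso; assert (H := stepf_le N p ltac:(lia) ltac:(right; lra)); lra.
- apply mle2_finite; intros i Hi.
  replace (eta * F i) with ((INR (S i) * eta - INR i * eta) * (F i - 0)) by (rewrite S_INR; ring).
  apply mle2_rectangle; auto; [|apply F_ge0; lia].
  rewrite S_INR; lra.
Qed.

End Step.

(** The rectangles of the right endpoint sum lie below the graph. Peeling off the last column by a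
    vertical cut replaces additivity over disjoint rectangles. *)
Lemma riemann_sum_le (f : R -> R) eta s n :
  eta > 0 -> (forall x, 0 <= x -> 0 <= f x) -> (forall x y, 0 <= x <= y -> f y <= f x) ->
  mle2 (subgraph f) s -> eta * Sum n (fun i => f (INR (S i) * eta)) <= s.
Proof.
intros He Hf0 Hf H.
assert (Key : forall s, mle2 (fun x y => subgraph f x y /\ x <= INR n * eta) s ->
  eta * Sum n (fun i => f (INR (S i) * eta)) <= s).
{ clear s H; induction n; intros s H; cbn [Sum].
  - apply mle2_ge0 in H; lra.
  - destruct (fun H1 H2 => mle2_split_x _ (fun x y => subgraph f x y /\ x <= INR n * eta)
      (fun x y => subgraph f x y /\ INR n * eta <= x <= INR (S n) * eta) (INR n * eta) _ H1 H2 H)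
      as [s1 [s2 [S1 [S2 S3]]]].
    + intros x y [H1 H2]; repeat split; try apply H1; auto; rewrite S_INR; lra.
    + intros x y [H1 H2]; repeat split; try apply H1; lra.
    + specialize (IHn _ S1).
      assert (Hn : 0 <= INR n * eta) by (apply Rmult_le_pos; [apply pos_INR|lra]).
      assert (H0 : 0 <= INR (S n) * eta) by (rewrite S_INR; lra).
      assert (B : (INR (S n) * eta - INR n * eta) * (f (INR (S n) * eta) - 0) <= s2).
      { apply mle2_ge with (4 := S2); [rewrite S_INR; lra|apply Hf0; auto|].
        intros x y Hx Hy; assert (f (INR (S n) * eta) <= f x) by (apply Hf; lra).
        repeat split; lra. }
      replace (INR (S n) * eta - INR n * eta) with eta in B by (rewrite S_INR; ring).
      lra. }
apply Key, (mle2_mono _ (subgraph f) s s); auto; [tauto|lra].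
Qed.

(** * Growth dynamics *)

Definition down (Z : R -> R -> Prop) : Prop :=
  forall a b, Z a b -> forall x y, 0 <= x <= a -> 0 <= y <= b -> Z x y.

(** Since [Z] is closed downwards, upper bounds for the two measures can replace their values, and
    an infinite measure simply has no bound. Monotonicity of the growth then reduces to
    [mle1_mono]. *)
Lemma inZbar_iff Z (E1 E2 : R -> Prop) p q : down Z -> 0 <= p -> 0 <= q ->
  (inZbar Z (Rbar_addr (lm1 E1) p) (Rbar_addr (lm1 E2) q) <->
   exists s1 s2, mle1 E1 s1 /\ mle1 E2 s2 /\ Z (s1 + p) (s2 + q)).
Proof.
intros HZ Hp Hq; split.
- intros H.
  destruct (lm1 E1) as [s1| |] eqn:H1; simpl in H; try tauto.
  destruct (lm1 E2) as [s2| |] eqn:H2; simpl in H; try tauto.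
  apply lm1_Fin in H1; apply lm1_Fin in H2.
  exists s1, s2; split; [apply H1|split; [apply H2|auto]].
- intros [s1 [s2 [H1 [H2 H]]]].
  destruct (lm1_le _ _ H1) as [m1 [-> [M1 L1]]], (lm1_le _ _ H2) as [m2 [-> [M2 L2]]].
  apply mle1_ge0 in M1; apply mle1_ge0 in M2.
  simpl; apply (HZ _ _ H); lra.
Qed.

Lemma iterT_quadrant Z f g (A : R -> R -> Prop) n u v :
  (forall u v, A u v -> quadrant u v) -> iterT Z f g n A u v -> quadrant u v.
Proof. intros HA; destruct n as [|n]; [apply HA|intros H; apply H]. Qed.

Lemma iterT_antitone (Z Z' : R -> R -> Prop) f g A n u v : (forall x y, Z x y -> Z' x y) ->
  down Z -> down Z' -> (forall x, 0 <= x -> 0 <= f x) -> (forall x, 0 <= x -> 0 <= g x) ->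
  iterT Z' f g n A u v -> iterT Z f g n A u v.
Proof.
intros HZ DZ DZ' Hf Hg; revert u v; induction n as [|n IH]; intros u v; [auto|].
intros [[Hu Hv] [H|H]]; split; try (split; auto); [left; auto|right].
intros Hin; apply H.
apply inZbar_iff in Hin; auto; destruct Hin as [s1 [s2 [H1 [H2 H3]]]].
apply inZbar_iff; auto.
exists s1, s2; split; [|split; auto].
- apply (mle1_mono _ _ s1 s1) with (3 := H1); [intros x; apply IH|lra].
- apply (mle1_mono _ _ s2 s2) with (3 := H2); [intros x; apply IH|lra].
Qed.

Lemma spans_antitone (Z Z' : R -> R -> Prop) f g A : (forall x y, Z x y -> Z' x y) ->
  down Z -> down Z' -> profile f -> profile g -> spans Z' f g A -> spans Z f g A.
Proof.
intros HZ DZ DZ' Hf Hg H u v Huv; destruct (H u v Huv) as [n Hn].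
exists n; apply iterT_antitone with Z'; auto; [apply Hf|apply Hg].
Qed.

(** Moving towards the origin increases [f v] and [g u], and inductively lengthens the occupied rows
    and columns. So growth from the empty set fills the rectangle below every point that it
    reaches. *)
Lemma thin_iterT_down Z f g n u v u' v' : down Z -> profile f -> profile g ->
  0 <= u' <= u -> 0 <= v' <= v ->
  iterT Z f g n (fun _ _ => False) u v -> iterT Z f g n (fun _ _ => False) u' v'.
Proof.
intros DZ [Hf0 [Hf1 _]] [Hg0 [Hg1 _]]; revert u v u' v'.
induction n as [|n IH]; intros u v u' v' Hu Hv; [auto|].
intros [_ [H|H]]; split; try (split; lra); [left; apply (IH u v); auto|right].
intros Hin; apply H.
assert (f v <= f v') by (apply Hf1; auto); assert (g u <= g u') by (apply Hg1; auto).
assert (0 <= f v) by (apply Hf0; lra); assert (0 <= g u) by (apply Hg0; lra).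
apply inZbar_iff in Hin; auto; try lra; destruct Hin as [s1 [s2 [L1 [L2 L3]]]].
apply inZbar_iff; auto.
assert (G1 := mle1_ge0 _ _ L1); assert (G2 := mle1_ge0 _ _ L2).
exists s1, s2; split; [|split].
- apply (mle1_mono _ _ s1 s1) with (3 := L1); [|lra].
  intros x Hx; apply (IH x v); auto.
  apply iterT_quadrant in Hx; [|tauto]; destruct Hx; lra.
- apply (mle1_mono _ _ s2 s2) with (3 := L2); [|lra].
  intros x Hx; apply (IH u x); auto.
  apply iterT_quadrant in Hx; [|tauto]; destruct Hx; lra.
- apply (DZ _ _ L3); lra.
Qed.

(** Every row through the full square already has measure at least [B > M], so one step fills the
    strip [v <= B]; then every column does, and one more step fills the quadrant. *)
Lemma spans_of_large_square Z f g A n M B : down Z -> profile f -> profile g ->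
  (forall x y, Z x y -> x <= M /\ y <= M) -> 0 < B -> M < B ->
  (forall u v, 0 <= u <= B -> 0 <= v <= B -> iterT Z f g n A u v) -> spans Z f g A.
Proof.
intros DZ Hf Hg HM HB HMB H.
assert (H1 : forall u v, 0 <= u -> 0 <= v <= B -> iterT Z f g (S n) A u v).
{ intros u v Hu Hv; split; [split; lra|right]; intros Hin.
  apply inZbar_iff in Hin; auto; try (apply Hf || apply Hg; lra).
  destruct Hin as [s1 [s2 [L1 [_ HZ]]]].
  assert (B - 0 <= s1).
  { apply mle1_ge with (2 := L1); intros x Hx; apply H; lra. }
  assert (0 <= f v) by (apply Hf; lra).
  apply HM in HZ; lra. }
intros u v [Hu Hv]; exists (S (S n)); split; [split; lra|right]; intros Hin.
apply inZbar_iff in Hin; auto; try (apply Hf || apply Hg; lra).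
destruct Hin as [s1 [s2 [_ [L2 HZ]]]].
assert (B - 0 <= s2).
{ apply mle1_ge with (2 := L2); intros x Hx; apply (H1 u x); lra. }
assert (0 <= g u) by (apply Hg; lra).
apply HM in HZ; lra.
Qed.

(* Otherwise the union of the strips u < t and v < w would be stable. *)
Lemma thin_spans_barrier Z f g t w : down Z -> profile f -> profile g ->
  spans Z f g (fun _ _ => False) -> 0 <= t -> 0 <= w -> ~ Z (t + f w) (w + g t).
Proof.
intros DZ [Hf0 [Hf1 _]] [Hg0 [Hg1 _]] Hsp Ht Hw HZ.
(* Inside the corner [t <= u], [w <= v] a row meets at most [0, t) and a column at most [0, w), as
   long as the corner is empty. *)
assert (Key : forall n u v, t <= u -> w <= v -> ~ iterT Z f g n (fun _ _ => False) u v).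
{ induction n as [|n IH]; intros u v Hu Hv; [tauto|].
  intros [_ [H|H]]; [exact (IH _ _ Hu Hv H)|].
  apply H.
  assert (f v <= f w) by (apply Hf1; lra); assert (g u <= g t) by (apply Hg1; lra).
  assert (0 <= f v) by (apply Hf0; lra); assert (0 <= g u) by (apply Hg0; lra).
  apply inZbar_iff; auto.
  exists (t - 0), (w - 0); split; [|split].
  - apply mle1_interval; auto; intros x Hx; assert (Hq := Hx).
    apply iterT_quadrant in Hq; [|tauto]; destruct Hq.
    split; [lra|]; apply Rnot_lt_le; intros Hlt; apply (IH x v); auto; lra.
  - apply mle1_interval; auto; intros x Hx; assert (Hq := Hx).
    apply iterT_quadrant in Hq; [|tauto]; destruct Hq.
    split; [lra|]; apply Rnot_lt_le; intros Hlt; apply (IH u x); auto; lra.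
  - apply (DZ _ _ HZ); lra. }
destruct (Hsp t w) as [n Hn]; [split; auto|].
apply (Key n t w); auto; lra.
Qed.

(** * Rearrangement *)

Lemma finite_argmin (F : nat -> R) N : exists m, (m <= N)%nat /\ forall i, (i <= N)%nat -> F m <= F i.
Proof.
induction N as [|N [m [Hm IH]]].
- exists O; split; [lia|]; intros i Hi; replace i with O by lia; lra.
- destruct (Rle_dec (F m) (F (S N))) as [H|H].
  + exists m; split; [lia|]; intros i Hi; destruct (Nat.eq_dec i (S N)) as [->|]; [lra|apply IH; lia].
  + exists (S N); split; [lia|]; intros i Hi; destruct (Nat.eq_dec i (S N)) as [->|]; [lra|].
    specialize (IH i ltac:(lia)); lra.
Qed.

(** Selection sort: the minimum, at index [m], moves to position [N], and [F N] takes its slot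
    before the recursive call. That [tau] permutes is recorded as invariance of sums, the form in
    which costs and cell measures are regrouped. *)
Lemma decreasing_sort N : forall F : nat -> R, exists (F' : nat -> R) (tau : nat -> nat),
  (forall i, (i < N)%nat -> (tau i < N)%nat /\ F' (tau i) = F i) /\
  (forall i, (i < N)%nat -> exists k, (k < N)%nat /\ F' i = F k) /\
  (forall i j, (i <= j)%nat -> (j < N)%nat -> F' j <= F' i) /\
  (forall e, Sum N (fun i => e (tau i)) = Sum N e).
Proof.
induction N as [|N IH]; intros F.
{ exists F, (fun i => i); repeat split; intros; try lia; auto. }
destruct (finite_argmin F N) as [m [Hm Hmin]].
destruct (IH (fun i => if Nat.eq_dec i m then F N else F i)) as [F1 [tau1 [H1 [H2 [H3 H4]]]]].
exists (fun i => if Nat.eq_dec i N then F m else F1 i),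
  (fun i => if Nat.eq_dec i m then N else if Nat.eq_dec i N then tau1 m else tau1 i).
split; [|split; [|split]].
- intros i Hi; destruct (Nat.eq_dec i m) as [->|Him].
  + split; [lia|]; destruct (Nat.eq_dec N N); [auto|lia].
  + destruct (Nat.eq_dec i N) as [->|HiN].
    * destruct (H1 m ltac:(lia)) as [T1 T2]; split; [lia|].
      destruct (Nat.eq_dec (tau1 m) N); [lia|]; rewrite T2.
      destruct (Nat.eq_dec m m); [auto|lia].
    * destruct (H1 i ltac:(lia)) as [T1 T2]; split; [lia|].
      destruct (Nat.eq_dec (tau1 i) N); [lia|]; rewrite T2.
      destruct (Nat.eq_dec i m); [lia|auto].
- intros i Hi; destruct (Nat.eq_dec i N) as [->|HiN]; [exists m; split; [lia|auto]|].
  destruct (H2 i ltac:(lia)) as [k [Hk ->]].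
  destruct (Nat.eq_dec k m); [exists N|exists k]; split; auto; lia.
- intros i j Hij Hj; destruct (Nat.eq_dec j N) as [->|HjN].
  + destruct (Nat.eq_dec i N) as [->|HiN]; [lra|].
    destruct (H2 i ltac:(lia)) as [k [Hk ->]].
    destruct (Nat.eq_dec k m); apply Hmin; lia.
  + destruct (Nat.eq_dec i N); [lia|]; apply H3; lia.
- intros e; cbn [Sum].
  destruct (Nat.eq_dec m N) as [->|HmN].
  + destruct (Nat.eq_dec N N); [|lia]; f_equal; rewrite <- (H4 e); apply Sum_ext.
    intros i Hi; destruct (Nat.eq_dec i N); [lia|auto].
  + destruct (Nat.eq_dec N m); [lia|]; destruct (Nat.eq_dec N N); [|lia].
    rewrite (Sum_ext N _ (fun i => if Nat.eq_dec i m then e N else e (tau1 i))).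
    * rewrite Sum_subst by lia; rewrite H4; ring.
    * intros i Hi; destruct (Nat.eq_dec i m); [auto|]; destruct (Nat.eq_dec i N); [lia|auto].
Qed.

(** Supplies separate bounds for the grid cells, which an interval exchange can then permute without
    changing their sum. *)
Lemma mle1_split_cells (E : R -> Prop) eta s N : eta > 0 -> mle1 E s ->
  exists (e : nat -> R) r,
    (forall i, (i < N)%nat -> mle1 (fun x => E x /\ INR i * eta <= x <= INR (S i) * eta) (e i)) /\
    mle1 (fun x => E x /\ INR N * eta <= x) r /\ Sum N e + r <= s.
Proof.
intros He H; induction N as [|N [e [r [H1 [H2 H3]]]]].
- exists (fun _ => 0), s; split; [intros; lia|split; [|simpl; lra]].
  apply (mle1_mono _ E s s); auto; [tauto|lra].
- destruct (fun H1 H2' => mle1_split _ (fun x => E x /\ INR N * eta <= x <= INR (S N) * eta)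
    (fun x => E x /\ INR (S N) * eta <= x) (INR (S N) * eta) _ H1 H2' H2) as [s1 [s2 [S1 [S2 S3]]]].
  + intros x [Hx Hx']; repeat split; auto; lra.
  + intros x [Hx Hx']; repeat split; auto; rewrite S_INR in *; lra.
  + exists (fun i => if Nat.eq_dec i N then s1 else e i), s2; split; [|split; auto].
    * intros i Hi; destruct (Nat.eq_dec i N) as [->|]; [auto|apply H1; lia].
    * cbn [Sum]; destruct (Nat.eq_dec N N); [|lia].
      rewrite (Sum_ext N _ e); [lra|].
      intros i Hi; destruct (Nat.eq_dec i N); [lia|auto].
Qed.

Lemma grid_cell_left eta v : eta > 0 -> 0 <= v ->
  exists i : nat, INR i * eta <= v < INR (S i) * eta.
Proof.
intros He Hv.
assert (H : exists n : nat, v < INR n * eta).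
{ destruct (INR_unbounded (v / eta)) as [n Hn]; exists n.
  apply Rmult_lt_reg_r with (/ eta); [apply Rinv_0_lt_compat; auto|].
  rewrite Rmult_assoc, Rinv_r by lra; unfold Rdiv in Hn; lra. }
destruct H as [n Hn]; induction n as [|n IH]; [simpl in Hn; lra|].
destruct (Rlt_dec v (INR n * eta)); auto.
exists n; lra.
Qed.

Definition ind1 (j : box1) (v : R) : R :=
  if Rle_dec (fst j) v then if Rle_dec v (snd j) then 1 else 0 else 0.

(* Discretize [f + sum_k w_k 1_(J_k)] from above on a grid, then sort the cells in decreasing
   order; [Psi] is the interval exchange which moves every cell to its new place. *)
Lemma profile_rearrange (f : R -> R) i1 m (w : nat -> R) (J : nat -> box1) eps :
  profile f -> mle2 (subgraph f) i1 -> (forall k, 0 <= w k) -> (forall k, valid1 (J k)) -> eps > 0 ->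
  exists (f' Psi : R -> R) L, profile f' /\
    mle2 (subgraph f') (i1 + Sum m (fun k => w k * vol1 (J k)) + eps) /\
    (forall v, 0 <= v -> 0 <= Psi v) /\
    (forall v, 0 <= v -> L <= v -> Psi v = v) /\
    (forall v, 0 <= v -> f v + Sum m (fun k => w k * ind1 (J k) v) <= f' (Psi v)) /\
    (forall E s, mle1 E s -> mle1 (fun x => 0 <= x /\ E (Psi x)) s).
Proof.
intros Pf Hi1 Hw HJ Heps.
assert (Pf' := Pf); destruct Pf' as [f0 [f1 [_ [M0 HM0]]]].
(* Beyond [L] both [f] and all the indicators vanish, so the exchange can fix every point there. *)
set (L := 1 + Rabs M0 + Sum m (fun k => Rabs (snd (J k)))).
assert (HSa : 0 <= Sum m (fun k => Rabs (snd (J k)))) by (apply Sum_ge0; intros; apply Rabs_pos).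
assert (HL : L >= 1) by (unfold L; assert (H := Rabs_pos M0); lra).
assert (HLf : forall v, L <= v -> f v = 0).
{ intros v Hv; apply HM0; unfold L in Hv; assert (H := Rle_abs M0); lra. }
assert (HLJ : forall k v, (k < m)%nat -> L <= v -> snd (J k) < v).
{ intros k v Hk Hv.
  assert (H := Sum_term_le m (fun k => Rabs (snd (J k))) k Hk (fun i => Rabs_pos _)).
  assert (H' := Rle_abs (snd (J k))); assert (H'' := Rabs_pos M0); simpl in H; unfold L in Hv; lra. }
set (W := Sum m w).
assert (HW : 0 <= W) by (apply Sum_ge0; auto).
(* The discretization costs at most [eta * K]: [eta * f 0] for sampling [f] at left endpoints, and
   [2 * eta * W] for widening each interval by [eta] at both ends. *)
set (K := f 0 + 2 * W).
assert (Hf00 : 0 <= f 0) by (apply f0; lra).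
assert (HK : 0 <= K) by (unfold K; lra).
destruct (INR_unbounded (L * K / eps)) as [n0 Hn0].
set (N := S n0).
assert (HN : 0 < INR N) by (apply lt_0_INR; unfold N; lia).
set (eta := L / INR N).
assert (Heta : eta > 0) by (apply Rdiv_lt_0_compat; lra).
assert (HNeta : INR N * eta = L) by (unfold eta; field; lra).
assert (HetaK : eta * K <= eps).
{ assert (L * K / eps <= INR N) by (unfold N; rewrite S_INR; lra).
  unfold eta; apply Rmult_le_reg_r with (INR N / eps); [apply Rdiv_lt_0_compat; lra|].
  replace (L / INR N * K * (INR N / eps)) with (L * K / eps) by (field; lra).
  replace (eps * (INR N / eps)) with (INR N) by (field; lra). auto. }
(* After widening, every cell that meets [J k] lies inside [J' k], so its covered fraction [part] is
   1 there. *)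
set (J' := fun k => (fst (J k) - eta, snd (J k) + eta)).
assert (HJ' : forall k, valid1 (J' k)).
{ intros k; specialize (HJ k); unfold J', valid1 in *; simpl; lra. }
set (part := fun k i => (clamp (J' k) (INR (S i) * eta) - clamp (J' k) (INR i * eta)) / eta).
assert (part_ge0 : forall k i, 0 <= part k i).
{ intros k i; apply Rmult_le_pos; [|left; apply Rinv_0_lt_compat; auto].
  assert (H : clamp (J' k) (INR i * eta) <= clamp (J' k) (INR (S i) * eta)).
  { apply clamp_incr; rewrite S_INR; lra. }
  lra. }
set (F := fun i => f (INR i * eta) + Sum m (fun k => w k * part k i)).
assert (grid_ge0 : forall i, 0 <= INR i * eta).
{ intros i; apply Rmult_le_pos; [apply pos_INR|lra]. }
assert (F_ge0 : forall i, 0 <= F i).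
{ intros i; apply Rplus_le_le_0_compat; [apply f0; auto|].
  apply Sum_ge0; intros; apply Rmult_le_pos; auto. }
destruct (decreasing_sort N F) as [F' [tau [H1 [H2 [H3 H4]]]]].
(* [stepf] telescopes down to the value at [N], so the sorted list must end with 0. *)
set (G := fun i => if le_lt_dec N i then 0 else F' i).
assert (G_decr : forall i, G (S i) <= G i).
{ intros i; unfold G; destruct (le_lt_dec N (S i)), (le_lt_dec N i); try lra; try lia.
  - destruct (H2 i) as [k [_ ->]]; auto.
  - apply H3; lia. }
assert (G_N : G N = 0) by (unfold G; destruct (le_lt_dec N N); [auto|lia]).
assert (HG : forall i, (i < N)%nat -> G i = F' i).
{ intros i Hi; unfold G; destruct (le_lt_dec N i); [lia|auto]. }
set (cell := fun v => epsilon (inhabits O) (fun i => INR i * eta <= v < INR (S i) * eta)).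
assert (Hcell : forall v, 0 <= v -> INR (cell v) * eta <= v < INR (S (cell v)) * eta).
{ intros v Hv; unfold cell; apply epsilon_spec, grid_cell_left; auto. }
set (Psi := fun v => if le_lt_dec N (cell v) then v else v + (INR (tau (cell v)) - INR (cell v)) * eta).
assert (Pstep := stepf_profile N eta G G_decr).
exists (stepf N eta G), Psi, L; repeat split; try apply Pstep.
- apply (mle2_mono _ (subgraph (stepf N eta G))) with (s' := eta * Sum N G); auto;
    [|apply stepf_integral; auto].
  rewrite (Sum_ext N G F') by auto; rewrite <- (H4 F').
  rewrite (Sum_ext N _ F) by (intros i Hi; apply H1; auto).
  unfold F; rewrite Sum_plus, Rmult_plus_distr_l.
  assert (A1 : eta * Sum N (fun i => f (INR i * eta)) <= eta * f 0 + i1).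
  { unfold N; rewrite Sum_shift, Rmult_plus_distr_l; simpl (INR 0); rewrite Rmult_0_l.
    apply Rplus_le_compat_l, riemann_sum_le; auto. }
  assert (A2 : eta * Sum N (fun i => Sum m (fun k => w k * part k i)) <=
    Sum m (fun k => w k * vol1 (J k)) + eta * (2 * W)).
  { rewrite Sum_exchange, <- Sum_scal.
    apply Rle_trans with (Sum m (fun k => w k * vol1 (J k) + 2 * eta * w k)).
    - apply Sum_le; intros k Hk; rewrite Sum_scal.
      replace (eta * (w k * Sum N (part k)))
        with (w k * Sum N (fun i => eta * part k i)) by (rewrite Sum_scal; ring).
      replace (w k * vol1 (J k) + 2 * eta * w k) with (w k * (vol1 (J k) + 2 * eta)) by ring.
      apply Rmult_le_compat_l; auto.
      rewrite (Sum_ext N _ (fun i => clamp (J' k) (INR (S i) * eta) - clamp (J' k) (INR i * eta)))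
        by (intros; unfold part; field; lra).
      rewrite (Sum_telescope N (fun i => clamp (J' k) (INR i * eta))).
      assert (R1 := clamp_range (J' k) (INR N * eta) (HJ' k)).
      assert (R2 := clamp_range (J' k) (INR 0 * eta) (HJ' k)).
      change (fst (J' k)) with (fst (J k) - eta) in R1, R2.
      change (snd (J' k)) with (snd (J k) + eta) in R1, R2.
      unfold vol1; lra.
    - rewrite Sum_plus, Sum_scal; fold W; lra. }
  unfold K in HetaK; lra.
- intros v Hv; unfold Psi; destruct (le_lt_dec N (cell v)); auto.
  specialize (Hcell v Hv); specialize (grid_ge0 (tau (cell v))); lra.
- intros v Hv HvL; unfold Psi; destruct (le_lt_dec N (cell v)) as [|Hlt]; auto; exfalso.
  specialize (Hcell v Hv).
  assert (INR (S (cell v)) * eta <= INR N * eta); [|lra].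
  apply Rmult_le_compat_r; [lra|apply le_INR; lia].
- intros v Hv; unfold Psi; specialize (Hcell v Hv).
  destruct (le_lt_dec N (cell v)) as [Hge|Hlt].
  + assert (HvL : L <= v).
    { rewrite <- HNeta; apply Rle_trans with (INR (cell v) * eta); [|lra].
      apply Rmult_le_compat_r; [lra|apply le_INR; lia]. }
    rewrite HLf by auto; rewrite (Sum_ext _ _ (fun _ => 0)).
    * rewrite Sum_const; assert (0 <= stepf N eta G v) by (apply Pstep; auto); lra.
    * intros k Hk; specialize (HLJ k v Hk HvL); unfold ind1.
      destruct (Rle_dec (fst (J k)) v); [|ring]; destruct (Rle_dec v (snd (J k))); [lra|ring].
  + destruct (H1 (cell v) Hlt) as [T1 T2].
    apply Rle_trans with (G (tau (cell v))).
    * rewrite HG, T2 by auto; unfold F; apply Rplus_le_compat; [apply f1; split; [auto|lra]|].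
      apply Sum_le; intros k Hk; apply Rmult_le_compat_l; auto.
      unfold ind1; destruct (Rle_dec (fst (J k)) v); auto.
      destruct (Rle_dec v (snd (J k))); auto.
      unfold part; rewrite S_INR in *; rewrite !clamp_id; [right; field; lra| |];
        unfold J', mem1; simpl; lra.
    * apply stepf_ge; auto; rewrite S_INR in *; lra.
(* The preimage of [E] under [Psi] meets cell [i] in a translate of the part of [E] in cell [tau i];
   the bounds [e] are only permuted. *)
- intros E s HE; destruct (mle1_split_cells E eta s N Heta HE) as [e [r [E1 [E2 E3]]]].
  apply (mle1_mono _ (fun x => (exists i, (i < N)%nat /\
    (E (x + (INR (tau i) - INR i) * eta) /\ INR (tau i) * eta <= x + (INR (tau i) - INR i) * eta <= INR (S (tau i)) * eta))
    \/ (E x /\ INR N * eta <= x))) with (s' := Sum N (fun i => e (tau i)) + r).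
  + intros x [Hx HEx]; unfold Psi in HEx; specialize (Hcell x Hx).
    destruct (le_lt_dec N (cell x)) as [Hge|Hlt].
    * right; split; auto; apply Rle_trans with (INR (cell x) * eta); [|lra].
      apply Rmult_le_compat_r; [lra|apply le_INR; lia].
    * left; exists (cell x); split; [auto|split; [auto|]]; rewrite S_INR in *; lra.
  + rewrite H4; auto.
  + apply mle1_union; auto; apply mle1_finite; intros i Hi.
    apply (mle1_translate (fun x => E x /\ INR (tau i) * eta <= x <= INR (S (tau i)) * eta)).
    apply E1, H1; auto.
Qed.

(** Takes the place of Fubini: the row is dominated by a step function of [v] whose integral is the
    total volume of the boxes. *)
Lemma slice_le (A : R -> R -> Prop) (c : nat -> box2) m v :
  (forall n, valid2 (c n)) -> (forall x y, A x y -> exists n, (n < m)%nat /\ mem2 (c n) (x, y)) ->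
  mle1 (fun x => A x v) (Sum m (fun k => vol1 (fst (c k)) * ind1 (snd (c k)) v)).
Proof.
intros V C.
apply (mle1_mono _ (fun x => exists k, (k < m)%nat /\ mem2 (c k) (x, v))) with (2 := Rle_refl _).
- intros x Hx; auto.
- apply mle1_finite; intros k Hk; unfold ind1, mem2, mem1; simpl.
  destruct (Rle_dec _ v) as [H1|H1]; [destruct (Rle_dec v _) as [H2|H2]|].
  + rewrite Rmult_1_r; apply mle1_interval; [apply V|tauto].
  + rewrite Rmult_0_r; apply mle1_empty; tauto.
  + rewrite Rmult_0_r; apply mle1_empty; tauto.
Qed.

Theorem thin_of_spanning Z M A f g a i1 i2 eps : down Z ->
  (forall x y, Z x y -> x <= M /\ y <= M) -> compact2 A -> (forall u v, A u v -> quadrant u v) ->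
  profile f -> profile g -> spans Z f g A ->
  mle2 A a -> mle2 (subgraph f) i1 -> mle2 (subgraph g) i2 -> eps > 0 ->
  exists f' g', profile f' /\ profile g' /\ spans Z f' g' (fun _ _ => False) /\
    mle2 (subgraph f') (i1 + a + eps) /\ mle2 (subgraph g') (i2 + a + eps).
Proof.
intros DZ HM CA QA Pf Pg Hsp Ha Hi1 Hi2 Heps.
destruct (compact_finite_cover A a (eps / 2) CA Ha) as [c [m [V [C Sc]]]]; [lra|].
destruct (profile_rearrange f i1 m (fun k => vol1 (fst (c k))) (fun k => snd (c k)) (eps / 2))
  as [f' [Psi [L1 [Pf' [If' [Psi0 [PsiL [Fle Psim]]]]]]]]; auto.
{ intros k; apply vol1_ge0, V. }
{ intros k; apply V. }
{ lra. }
destruct (profile_rearrange g i2 m (fun k => vol1 (snd (c k))) (fun k => fst (c k)) (eps / 2))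
  as [g' [Phi [L2 [Pg' [Ig' [Phi0 [PhiL [Gle Phim]]]]]]]]; auto.
{ intros k; apply vol1_ge0, V. }
{ intros k; apply V. }
{ lra. }
exists f', g'; split; [auto|split; [auto|split; [|split]]].
(* Invariant of the comparison: outside [A], the map ([Phi], [Psi]) sends the growth from [A] into
   the growth from the empty set, step by step. *)
- assert (Key : forall n u v, iterT Z f g n A u v ->
    A u v \/ iterT Z f' g' n (fun _ _ => False) (Phi u) (Psi v)).
  { induction n as [|n IH]; intros u v; [auto|].
    intros [[Hu Hv] [H|H]].
    - destruct (IH u v H) as [HA|HO]; [auto|right].
      split; [split; auto|left; auto].
    - right; split; [split; auto|right]; intros Hin; apply H; clear H.
      assert (0 <= f v) by (apply Pf; auto); assert (0 <= g u) by (apply Pg; auto).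
      apply inZbar_iff in Hin; auto; try (apply Pf' || apply Pg'; auto).
      destruct Hin as [s1 [s2 [R1 [R2 HZ]]]].
      apply inZbar_iff; auto.
      specialize (Fle v Hv); specialize (Gle u Hu).
      assert (G1 := mle1_ge0 _ _ R1); assert (G2 := mle1_ge0 _ _ R2).
      assert (B1 := slice_le A c m v V C).
      assert (B2 := slice_le (fun x y => A y x) (fun n => (snd (c n), fst (c n))) m u).
      simpl in B2; specialize (B2 ltac:(intros k; split; apply V)).
      specialize (B2 ltac:(intros x y HA; destruct (C y x HA) as [k [Hk [M1 M2]]];
        exists k; repeat split; auto; apply M1 || apply M2)).
      assert (G3 := mle1_ge0 _ _ B1); assert (G4 := mle1_ge0 _ _ B2).
      (* Row [v] is covered by the slice of [A], which [Fle] charges to [f' (Psi v) - f v], and by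
         the preimage under [Phi] of the rearranged row, of measure at most [s1]. Columns are
         symmetric. *)
      eexists _, _; split; [|split].
      + eapply (mle1_mono _ (fun x => A x v \/ (0 <= x /\
          iterT Z f' g' n (fun _ _ => False) (Phi x) (Psi v)))) with (2 := Rle_refl _).
        * intros x Hx; assert (Hq := iterT_quadrant _ _ _ _ _ _ _ QA Hx); destruct Hq.
          destruct (IH x v Hx); auto.
        * apply mle1_union; [exact B1|exact (Phim _ _ R1)].
      + eapply (mle1_mono _ (fun y => A u y \/ (0 <= y /\
          iterT Z f' g' n (fun _ _ => False) (Phi u) (Psi y)))) with (2 := Rle_refl _).
        * intros y Hy; assert (Hq := iterT_quadrant _ _ _ _ _ _ _ QA Hy); destruct Hq.
          destruct (IH u y Hy); auto.
        * apply mle1_union; [exact B2|exact (Psim _ _ R2)].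
      + apply (DZ _ _ HZ); lra. }
  destruct CA as [_ [MA HMA]].
  (* The point (B, B) lies outside [A] and is fixed by ([Phi], [Psi]), so it is also reached from
     the empty set; [thin_iterT_down] then fills a square larger than [Z]. *)
  set (B := 1 + Rabs M + Rabs MA + Rabs L1 + Rabs L2).
  assert (P1 := Rabs_pos M); assert (P2 := Rabs_pos MA); assert (P3 := Rabs_pos L1); assert (P4 := Rabs_pos L2).
  assert (Q1 := Rle_abs M); assert (Q2 := Rle_abs MA); assert (Q3 := Rle_abs L1); assert (Q4 := Rle_abs L2).
  assert (HB : 0 <= B) by (unfold B; lra).
  destruct (Hsp B B) as [n Hn]; [split; auto|].
  destruct (Key n B B Hn) as [HA|HO].
  { exfalso; apply HMA in HA; assert (H := Rle_abs B); unfold B in *; lra. }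
  rewrite PhiL, PsiL in HO by (unfold B in *; lra).
  apply (spans_of_large_square Z f' g' _ n M B); auto; try (unfold B; lra).
  intros u v Hu Hv; apply (thin_iterT_down Z f' g' n B B); auto.
- apply (mle2_mono _ (subgraph f')) with (3 := If'); auto.
  rewrite (Sum_ext _ _ (fun k => vol2 (c k))) by (intros; unfold vol2; ring); lra.
- apply (mle2_mono _ (subgraph g')) with (3 := Ig'); auto.
  rewrite (Sum_ext _ _ (fun k => vol2 (c k))) by (intros; unfold vol2; ring); lra.
Qed.

(** * Spanning costs for bounded zero-sets *)

(** A truncation need not be a [zero_set], for instance at [M = 0]; these are the properties that
    survive. *)
Definition zone (Z : R -> R -> Prop) (M : R) : Prop :=
  down Z /\ forall x y, Z x y -> 0 <= x <= M /\ 0 <= y <= M.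

Lemma zone_truncate Z M : zero_set Z -> zone (truncate Z M) M.
Proof.
intros [Hq [_ [Hd _]]]; split.
- intros a b [H [Ha Hb]] x y Hx Hy; split; [apply (Hd a b); auto|lra].
- intros x y [H [Hx Hy]]; destruct (Hq x y H); lra.
Qed.

Lemma zone_le Z M : zone Z M -> forall x y, Z x y -> x <= M /\ y <= M.
Proof. intros [_ H] x y Hxy; specialize (H x y Hxy); lra. Qed.

(* Rows of Z, widened by [eta] and shifted up by one grid cell, so that each step fills a cell. *)
Lemma thin_spanning_area Z M a eps : zone Z M -> mle2 Z a -> eps > 0 ->
  exists f, profile f /\ spans Z f (fun _ => 0) (fun _ _ => False) /\ mle2 (subgraph f) (a + eps).
Proof.
intros HZ Ha Heps; assert (DZ := proj1 HZ); assert (HM := zone_le Z M HZ).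
assert (HM0 := Rabs_pos M); assert (HM1 := Rle_abs M).
(* The length of the row of [Z] at height [v]; adjoining 0 gives empty rows a least upper bound. *)
set (phi := fun v => epsilon (inhabits 0) (is_lub (fun x => x = 0 \/ Z x v))).
assert (Hphi : forall v, is_lub (fun x => x = 0 \/ Z x v) (phi v)).
{ intros v; unfold phi; apply epsilon_spec.
  destruct (completeness (fun x => x = 0 \/ Z x v)) as [m Hm]; [|eauto|eauto].
  exists (Rabs M); intros x [->|Hx]; [lra|]; apply HM in Hx; lra. }
assert (phi_ge0 : forall v, 0 <= phi v) by (intros v; apply (Hphi v); auto).
assert (phi_le : forall v, phi v <= Rabs M).
{ intros v; apply (Hphi v); intros x [->|Hx]; [lra|]; apply HM in Hx; lra. }
assert (phi_decr : forall x y, 0 <= x <= y -> phi y <= phi x).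
{ intros x y Hxy; apply (Hphi y); intros z [->|Hz]; [auto|].
  apply (Hphi x); right; apply (DZ z y Hz); [destruct HZ as [_ H]; apply H in Hz; lra|lra]. }
assert (phi_sub : mle2 (subgraph phi) a).
{ apply (mle2_mono _ (fun x y => Z y x) a a); [|lra|apply mle2_swap; auto].
  intros x y [Hx [Hy Hxy]]; apply NNPP; intros Hn.
  assert (phi x <= y); [|lra].
  apply (Hphi x); intros z [->|Hz]; [auto|].
  apply Rnot_lt_le; intros Hlt; apply Hn, (DZ z x Hz); lra. }
set (L := Rabs M + 1).
(* One [L] bounds the initial term [phi 0] of the left endpoint sum, the other is [INR N * eta], the
   total widening. *)
set (K := L + L).
destruct (INR_unbounded (L * K / eps)) as [n0 Hn0].
set (N := S n0).
assert (HN : 0 < INR N) by (apply lt_0_INR; unfold N; lia).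
assert (HL : 1 <= L) by (unfold L; lra).
set (eta := L / INR N).
assert (Heta : eta > 0) by (apply Rdiv_lt_0_compat; lra).
assert (HNeta : INR N * eta = L) by (unfold eta; field; lra).
assert (HetaK : eta * K <= eps).
{ assert (L * K / eps <= INR N) by (unfold N; rewrite S_INR; lra).
  unfold eta; apply Rmult_le_reg_r with (INR N / eps); [apply Rdiv_lt_0_compat; lra|].
  replace (L / INR N * K * (INR N / eps)) with (L * K / eps) by (field; lra).
  replace (eps * (INR N / eps)) with (INR N) by (field; lra). auto. }
assert (grid_ge0 : forall i, 0 <= INR i * eta).
{ intros i; apply Rmult_le_pos; [apply pos_INR|lra]. }
set (F := fun i => if le_lt_dec N i then 0 else phi (INR i * eta) + eta).
assert (F_decr : forall i, F (S i) <= F i).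
{ intros i; unfold F; destruct (le_lt_dec N (S i)), (le_lt_dec N i); try lra; try lia.
  - specialize (phi_ge0 (INR i * eta)); lra.
  - assert (phi (INR (S i) * eta) <= phi (INR i * eta)); [|lra].
    apply phi_decr; split; [auto|rewrite S_INR; lra]. }
assert (F_N : F N = 0) by (unfold F; destruct (le_lt_dec N N); [auto|lia]).
assert (HF : forall i, (i < N)%nat -> F i = phi (INR i * eta) + eta).
{ intros i Hi; unfold F; destruct (le_lt_dec N i); [lia|auto]. }
assert (Pf := stepf_profile N eta F F_decr).
exists (stepf N eta F); split; [auto|split].
- assert (Key : forall n, (n <= N)%nat -> forall u v, 0 <= u -> 0 <= v < INR n * eta ->
    iterT Z (stepf N eta F) (fun _ => 0) n (fun _ _ => False) u v).
  { induction n as [|n IH]; intros Hn u v Hu Hv; [simpl in Hv; lra|].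
    split; [split; lra|right]; intros Hin.
    apply inZbar_iff in Hin; auto; try lra; [|apply Pf; lra].
    destruct Hin as [s1 [s2 [R1 [R2 HZ']]]].
    assert (G1 := mle1_ge0 _ _ R1).
    assert (INR n * eta - 0 <= s2).
    { apply mle1_ge with (2 := R2); intros y Hy; apply IH; [lia|auto|lra]. }
    assert (Hst := stepf_ge N eta F Heta F_decr F_N n v ltac:(lia) ltac:(lra)).
    rewrite HF in Hst by lia.
    assert (phi (INR n * eta) + eta <= phi (INR n * eta)); [|lra].
    apply (Hphi (INR n * eta)); right; apply (DZ _ _ HZ').
    + specialize (phi_ge0 (INR n * eta)); lra.
    + split; [auto|lra]. }
  apply (spans_of_large_square Z _ _ _ N M (Rabs M + / 2)); auto using profile_zero; try lra.
  intros u v Hu Hv; apply Key; [lia|lra|rewrite HNeta; unfold L; lra].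
- apply (mle2_mono _ (subgraph (stepf N eta F))) with (s' := eta * Sum N F); auto;
    [|apply stepf_integral; auto].
  rewrite (Sum_ext N F (fun i => phi (INR i * eta) + eta)) by auto.
  rewrite Sum_plus, Sum_const, HNeta.
  unfold N; rewrite Sum_shift.
  assert (Hr := riemann_sum_le phi eta a n0 Heta ltac:(auto) phi_decr phi_sub).
  assert (eta * phi (INR 0 * eta) <= eta * L).
  { apply Rmult_le_compat_l; [lra|]; specialize (phi_le (INR 0 * eta)); unfold L; lra. }
  unfold K in HetaK; lra.
Qed.

Definition admissible (Z A : R -> R -> Prop) (f g : R -> R) (a i1 i2 : R) : Prop :=
  compact2 A /\ (forall u v, A u v -> quadrant u v) /\ profile f /\ profile g /\ spans Z f g A /\
  area A = Fin a /\ integral0 f = Fin i1 /\ integral0 g = Fin i2.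

Lemma admissible_ge0 Z A f g a i1 i2 : admissible Z A f g a i1 i2 -> 0 <= a /\ 0 <= i1 /\ 0 <= i2.
Proof.
intros [_ [_ [_ [_ [_ [Ha [H1 H2]]]]]]].
apply lm2_Fin in Ha; apply integral0_Fin in H1; apply integral0_Fin in H2.
repeat split; eapply mle2_ge0; [apply Ha|apply H1|apply H2].
Qed.

Lemma admissible_thin Z f g i1 i2 : profile f -> profile g -> spans Z f g (fun _ _ => False) ->
  integral0 f = Fin i1 -> integral0 g = Fin i2 -> admissible Z (fun _ _ => False) f g 0 i1 i2.
Proof.
intros Pf Pg Hs H1 H2; split; [split|].
- intros x y H; destruct (H 1) as [u [v [[] _]]]; lra.
- exists 0; tauto.
- repeat split; try tauto; try apply Pf; try apply Pg; auto.
  destruct (lm2_le (fun _ _ => False) 0) as [m [Em [Hm Hm0]]]; [apply mle2_empty; auto|].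
  unfold area; rewrite Em; apply mle2_ge0 in Hm; f_equal; lra.
Qed.

Lemma thin_le_area Z M a eps : zone Z M -> mle2 Z a -> eps > 0 ->
  exists f i, profile f /\ spans Z f (fun _ => 0) (fun _ _ => False) /\ integral0 f = Fin i /\
    i <= a + eps.
Proof.
intros HZ Ha Heps.
destruct (thin_spanning_area Z M a eps HZ Ha Heps) as [f [Pf [Sf If]]].
destruct (integral0_le _ _ If) as [i [Hi Hi']]; exists f, i; auto.
Qed.

Lemma I_bdd_admissible al be Z : I_bdd al be Z =
  Rbar_inf (fun w => exists A f g a i1 i2, admissible Z A f g a i1 i2 /\
    w = Fin (a + (1 - al) * i1 + (1 - be) * i2)).
Proof.
unfold I_bdd, admissible; f_equal; apply pred_ext; intros w.
split; intros [A [f [g [a [i1 [i2 H]]]]]]; exists A, f, g, a, i1, i2; tauto.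
Qed.

(** The upper bound [(1 - al) * a] is the cost of empty [A], zero [g], and the [f] of
    [thin_spanning_area]. *)
Lemma I_bdd_spec al be Z M a : zone Z M -> mle2 Z a -> 0 <= al <= 1 -> 0 <= be <= 1 ->
  exists y, I_bdd al be Z = Fin y /\ 0 <= y <= (1 - al) * a /\
    (forall A f g a' i1 i2, admissible Z A f g a' i1 i2 ->
       y <= a' + (1 - al) * i1 + (1 - be) * i2) /\
    (forall c, (forall A f g a' i1 i2, admissible Z A f g a' i1 i2 ->
       c <= a' + (1 - al) * i1 + (1 - be) * i2) -> c <= y).
Proof.
intros HZ Ha Hal Hbe.
destruct (thin_le_area Z M a 1 HZ Ha ltac:(lra)) as [f0 [i0 [Pf0 [Sf0 [If0 Li0]]]]].
rewrite I_bdd_admissible; match goal with |- context [Rbar_inf ?Q] => set (P := Q) end.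
destruct (Rbar_inf_Fin P 0) as [y [Ey [Hy0 [Hy1 Hy2]]]].
- assert (Hadm := admissible_thin _ _ _ _ _ Pf0 profile_zero Sf0 If0 integral0_zero).
  eexists; exists (fun _ _ => False), f0, (fun _ => 0), 0, i0, 0; split; [exact Hadm|reflexivity].
- intros x [A [f [g [a' [i1 [i2 [Hadm ->]]]]]]]; simpl.
  destruct (admissible_ge0 _ _ _ _ _ _ _ Hadm) as [G1 [G2 G3]].
  assert (0 <= (1 - al) * i1) by (apply Rmult_le_pos; lra).
  assert (0 <= (1 - be) * i2) by (apply Rmult_le_pos; lra). lra.
- assert (Hle : forall A f g a' i1 i2, admissible Z A f g a' i1 i2 ->
       y <= a' + (1 - al) * i1 + (1 - be) * i2).
  { intros A f g a' i1 i2 Hadm; apply Hy1; exists A, f, g, a', i1, i2; auto. }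
  exists y; split; [auto|split; [split; [auto|]|split; [auto|]]].
  + apply Rnot_lt_le; intros Hlt.
    destruct (thin_le_area Z M a ((y - (1 - al) * a) / 2) HZ Ha ltac:(lra)) as [f [i [Pf [Sf [If Li]]]]].
    assert (H := Hle _ _ _ _ _ _ (admissible_thin _ _ _ _ _ Pf profile_zero Sf If integral0_zero)).
    assert ((1 - al) * i <= (1 - al) * (a + (y - (1 - al) * a) / 2)) by (apply Rmult_le_compat_l; lra).
    assert ((1 - al) * ((y - (1 - al) * a) / 2) <= 1 * ((y - (1 - al) * a) / 2))
      by (apply Rmult_le_compat_r; lra).
    lra.
  + intros c Hc; apply Hy2.
    intros x [A [f [g [a' [i1 [i2 [Hadm ->]]]]]]]; simpl.
    apply (Hc A f g); auto.
Qed.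

Lemma gthin_bdd_spec Z M a : zone Z M -> mle2 Z a ->
  exists y, gthin_bdd Z = Fin y /\ 0 <= y <= a /\
    (forall f g i1 i2, profile f -> profile g -> spans Z f g (fun _ _ => False) ->
       integral0 f = Fin i1 -> integral0 g = Fin i2 -> y <= i1 + i2) /\
    (forall c, (forall f g i1 i2, profile f -> profile g -> spans Z f g (fun _ _ => False) ->
       integral0 f = Fin i1 -> integral0 g = Fin i2 -> c <= i1 + i2) -> c <= y).
Proof.
intros HZ Ha.
destruct (thin_le_area Z M a 1 HZ Ha ltac:(lra)) as [f0 [i0 [Pf0 [Sf0 [If0 Li0]]]]].
unfold gthin_bdd; match goal with |- context [Rbar_inf ?Q] => set (P := Q) end.
destruct (Rbar_inf_Fin P 0) as [y [Ey [Hy0 [Hy1 Hy2]]]].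
- exists (i0 + 0), f0, (fun _ => 0), i0, 0; auto 10 using integral0_zero, profile_zero.
- intros x [f [g [i1 [i2 [D3 [D4 [D5 [D7 [D8 ->]]]]]]]]]; simpl.
  destruct (admissible_ge0 _ _ _ _ _ _ _ (admissible_thin _ _ _ _ _ D3 D4 D5 D7 D8)); lra.
- assert (Hle : forall f g i1 i2, profile f -> profile g -> spans Z f g (fun _ _ => False) ->
       integral0 f = Fin i1 -> integral0 g = Fin i2 -> y <= i1 + i2).
  { intros f g i1 i2 D1 D2 D3 D4 D5; apply Hy1; exists f, g, i1, i2; auto 10. }
  exists y; split; [auto|split; [split; [auto|]|split; [auto|]]].
  + apply Rnot_lt_le; intros Hlt.
    destruct (thin_le_area Z M a ((y - a) / 2) HZ Ha ltac:(lra)) as [f [i [Pf [Sf [If Li]]]]].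
    assert (H := Hle _ _ _ _ Pf profile_zero Sf If integral0_zero); lra.
  + intros c Hc; apply Hy2.
    intros x [f [g [i1 [i2 [D3 [D4 [D5 [D7 [D8 ->]]]]]]]]]; simpl; eauto.
Qed.

Lemma thin_lower_bound_le_cost Z M A f g a i1 i2 y : zone Z M -> admissible Z A f g a i1 i2 ->
  (forall f g i1 i2, profile f -> profile g -> spans Z f g (fun _ _ => False) ->
       integral0 f = Fin i1 -> integral0 g = Fin i2 -> y <= i1 + i2) ->
  y <= i1 + i2 + 2 * a.
Proof.
intros HZ [D1 [D2 [D3 [D4 [D5 [D6 [D7 D8]]]]]]] Hy.
apply Rnot_lt_le; intros Hlt.
destruct (thin_of_spanning Z M A f g a i1 i2 ((y - (i1 + i2 + 2 * a)) / 4))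
  as [f' [g' [P1 [P2 [P3 [P4 P5]]]]]]; auto.
- apply HZ.
- apply zone_le; auto.
- apply lm2_Fin; auto.
- apply integral0_Fin; auto.
- apply integral0_Fin; auto.
- lra.
- destruct (integral0_le _ _ P4) as [j1 [J1 L1]], (integral0_le _ _ P5) as [j2 [J2 L2]].
  specialize (Hy f' g' j1 j2 P1 P2 P3 J1 J2); lra.
Qed.

(** Swapping and reflecting [F], and reflecting [G], superimposes both on the rectangle. The
    alternative in the last hypothesis is what the barrier gives at (t, v) when (p, q) lies in
    [Z]. *)
Lemma rectangle_le_mle2 (F G : R -> R -> Prop) a b p q s1 s2 : 0 <= a -> 0 <= b ->
  mle2 F s1 -> mle2 G s2 ->
  (forall t v, 0 < t < a -> 0 < v < b -> F v (p - t) \/ G t (q - v)) -> a * b <= s1 + s2.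
Proof.
intros Ha Hb HF HG H.
replace (a * b) with ((a - 0) * (b - 0)) by ring.
apply (mle2_ge (fun t v => F v (p - t) \/ G t (q - v))); auto.
apply mle2_union; [|apply mle2_reflect; auto].
apply (mle2_swap (fun v t => F v (p - t))), mle2_reflect; auto.
Qed.

Lemma thin_ge_rectangle Z f g i1 i2 a b : down Z -> Z a b -> 0 <= a -> 0 <= b ->
  profile f -> profile g -> spans Z f g (fun _ _ => False) ->
  integral0 f = Fin i1 -> integral0 g = Fin i2 -> a * b <= i1 + i2.
Proof.
intros DZ Hab Ha Hb Pf Pg Hs H1 H2.
apply integral0_Fin in H1; apply integral0_Fin in H2.
apply (rectangle_le_mle2 (subgraph f) (subgraph g) a b a b); auto; [apply H1|apply H2|].
intros t v Ht Hv.
assert (Hbar := thin_spans_barrier Z f g t v DZ Pf Pg Hs ltac:(lra) ltac:(lra)).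
assert (0 <= f v) by (apply Pf; lra); assert (0 <= g t) by (apply Pg; lra).
destruct (Rlt_dec (a - t) (f v)); [left; repeat split; lra|].
destruct (Rlt_dec (b - v) (g t)); [right; repeat split; lra|].
exfalso; apply Hbar, (DZ a b Hab); lra.
Qed.

(* With [g] cheap, [g d <= d]; the barrier at [t = d] then puts Z, up to two strips of width d,
   inside the translated subgraph of [f]. *)
Lemma thin_area_le Z M f g i1 i2 a d : zone Z M -> 0 <= M -> mle2 (subgraph f) i1 -> mle2 (subgraph g) i2 ->
  profile f -> profile g -> spans Z f g (fun _ _ => False) -> area Z = Fin a ->
  0 < d -> i2 < d * d -> a <= i1 + 2 * M * d.
Proof.
intros [DZ HZ] HM H1 H2 Pf Pg Hs Ha Hd Hi2.
apply lm2_Fin in Ha; apply Ha; clear Ha.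
assert (Hg : g d <= d).
{ apply Rnot_lt_le; intros Hlt.
  assert ((d - 0) * (d - 0) <= i2); [|lra].
  apply (mle2_ge (subgraph g)); auto; try lra.
  intros x y Hx Hy; assert (g d <= g x) by (apply Pg; lra); repeat split; lra. }
apply (mle2_mono _ (fun x y => (0 <= x <= d /\ 0 <= y <= M) \/ ((0 <= x <= M /\ 0 <= y <= d) \/
  subgraph f (y + - d) (x + - d)))) with (s' := (d - 0) * (M - 0) + ((M - 0) * (d - 0) + i1)); [|lra|].
- intros x y Hxy; destruct (HZ x y Hxy) as [Hx Hy].
  destruct (Rle_dec x d); [left; lra|right].
  destruct (Rle_dec y d); [left; lra|right].
  split; [lra|split; [lra|]]; apply Rnot_le_lt; intros Hle.
  assert (0 <= f (y + - d)) by (apply Pf; lra); assert (0 <= g d) by (apply Pg; lra).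
  apply (thin_spans_barrier Z f g d (y + - d) DZ Pf Pg Hs); try lra.
  apply (DZ x y Hxy); lra.
- apply mle2_union; [apply mle2_rectangle; [lra|lra|intros; lra]|].
  apply mle2_union; [apply mle2_rectangle; [lra|lra|intros; lra]|].
  apply (mle2_translate (fun x y => subgraph f y x) (- d) (- d)), mle2_swap; auto.
Qed.

(** A triple of cost below [(1 - al) * a] has small area and small integral of [g], so after
    rearrangement [thin_area_le] applies. The threshold [d] is uniform in [al], which allows [M] to
    be fixed first in the limit. *)
Lemma I_bdd_ge_area Z M a kap : zone Z M -> area Z = Fin a -> kap > 0 ->
  exists d, d > 0 /\ forall al y, 1 - d < al < 1 -> 0 <= al -> I_bdd al 0 Z = Fin y ->
    (1 - al) * (a - kap) <= y.
Proof.
intros HZ Ha Hk.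
assert (Ha' := lm2_Fin _ _ Ha); destruct Ha' as [Ha1 Ha2].
assert (Ha0 := mle2_ge0 _ _ Ha1).
assert (HM0 := Rabs_pos M); assert (HM1 := Rle_abs M).
(* The two strips of width [dl] that [thin_area_le] gives away have total area at most [kap / 2]. *)
set (dl := kap / (4 * (Rabs M + 1))).
assert (Hdl : 0 < dl) by (apply Rdiv_lt_0_compat; lra).
assert (Hdlk : 2 * Rabs M * dl <= kap / 2).
{ assert (E : (Rabs M + 1) * dl = kap / 4) by (unfold dl; field; lra). lra. }
assert (Hdd : 0 < dl * dl) by (apply Rmult_lt_0_compat; auto).
(* Chosen so that [(1 - al) * a <= dl * dl / 2]; together with [e <= dl * dl / 2] this gives
   [i2 + a' + e < dl * dl]. *)
exists (dl * dl / (2 * (a + 1))); split; [apply Rdiv_lt_0_compat; lra|].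
intros al y Hal Hal0 Ey.
destruct (I_bdd_spec al 0 Z M a HZ Ha1 ltac:(lra) ltac:(lra)) as [y' [Ey' [_ [_ Hinf]]]].
assert (y' = y) by congruence; subst y'.
apply Hinf; intros A f g a' i1 i2 Hadm.
destruct (admissible_ge0 _ _ _ _ _ _ _ Hadm) as [G1 [G2 G3]].
destruct (Rle_dec ((1 - al) * a) (a' + (1 - al) * i1 + (1 - 0) * i2)) as [Hc|Hc].
{ assert (0 < (1 - al) * kap) by (apply Rmult_lt_0_compat; lra). lra. }
assert (0 <= (1 - al) * i1) by (apply Rmult_le_pos; lra).
assert (Hsmall : (1 - al) * a <= dl * dl / 2).
{ apply Rle_trans with (dl * dl / (2 * (a + 1)) * (a + 1)); [apply Rmult_le_compat; lra|].
  right; field; lra. }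
set (e := Rmin (dl * dl / 2) (kap / 2)).
assert (He : e > 0) by (apply Rmin_glb_lt; lra).
assert (He1 : e <= dl * dl / 2) by apply Rmin_l; assert (He2 : e <= kap / 2) by apply Rmin_r.
destruct Hadm as [D1 [D2 [D3 [D4 [D5 [D6 [D7 D8]]]]]]].
destruct (thin_of_spanning Z M A f g a' i1 i2 e) as [f' [g' [P1 [P2 [P3 [P4 P5]]]]]]; auto.
- apply HZ.
- apply zone_le; auto.
- apply lm2_Fin; auto.
- apply integral0_Fin; auto.
- apply integral0_Fin; auto.
- assert (HZ' : zone Z (Rabs M)).
  { destruct HZ as [H1 H2]; split; auto; intros u v Huv; specialize (H2 u v Huv); lra. }
  assert (B := thin_area_le Z (Rabs M) f' g' _ _ a dl HZ' HM0 P4 P5 P1 P2 P3 Ha Hdl ltac:(lra)).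
  assert ((1 - al) * (a - kap) <= (1 - al) * (i1 + a')) by (apply Rmult_le_compat_l; lra).
  assert ((1 - al) * a' <= 1 * a') by (apply Rmult_le_compat_r; lra). lra.
Qed.

(** Replaces continuity from below: past some index, a cover of finite volume has volume at most
    [eps] left, and [M] is taken beyond the boxes before it. What truncation removes is then covered
    by the tail. *)
Lemma area_truncate_tail Z a eps : zero_set Z -> area Z = Fin a -> eps > 0 ->
  exists M a', area (truncate Z M) = Fin a' /\ a - eps <= a'.
Proof.
intros [Hq _] Ha Heps.
apply lm2_Fin in Ha; destruct Ha as [Ha Hmin].
destruct (Ha 1 ltac:(lra)) as [c [V [C Sc]]].
assert (HN : exists N, forall n, Sum n (fun i => vol2 (c i)) <= Sum N (fun i => vol2 (c i)) + eps).
{ apply NNPP; intros Hn.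
  destruct (completeness (fun s => exists n, s = Sum n (fun i => vol2 (c i)))) as [l [Hl1 Hl2]].
  - exists (a + 1); intros s [n ->]; auto.
  - exists 0, O; reflexivity.
  - assert (l <= l - eps); [|lra].
    apply Hl2; intros s [N ->]; apply Rnot_lt_le; intros Hlt; apply Hn; exists N.
    intros n; assert (Sum n (fun i => vol2 (c i)) <= l) by (apply Hl1; eauto); lra. }
destruct HN as [N HN].
set (M := Sum N (fun n => Rabs (snd (fst (c n))) + Rabs (snd (snd (c n))))).
destruct (lm2_le (truncate Z M) a) as [a' [Ea' [Ma' _]]].
{ apply (mle2_mono _ Z a a); [intros x y H; apply H|lra|auto]. }
exists M, a'; split; [auto|].
assert (a <= a' + eps); [|lra].
apply Hmin.
apply (mle2_mono _ (fun x y => truncate Z M x y \/ (Z x y /\ (M < x \/ M < y))) _ (a' + eps)); [|lra|].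
- intros x y H; destruct (Rle_dec x M); [destruct (Rle_dec y M)|].
  + left; split; auto.
  + right; split; [auto|lra].
  + right; split; [auto|lra].
- apply mle2_union; auto.
  intros e He; exists (fun n => c (N + n)%nat); split; [intros n; apply V|split].
  + intros [x y] [Hxy Hout]; simpl in *.
    destruct (C (x, y) Hxy) as [n Hn].
    destruct (le_lt_dec N n) as [HNn|HNn]; [exists (n - N)%nat; replace (N + (n - N))%nat with n by lia; auto|].
    exfalso; destruct Hn as [[_ H1] [_ H2]]; simpl in *.
    assert (HT := Sum_term_le N (fun n => Rabs (snd (fst (c n))) + Rabs (snd (snd (c n)))) n HNn).
    specialize (HT ltac:(intros i; apply Rplus_le_le_0_compat; apply Rabs_pos)).
    fold M in HT; simpl in HT.
    assert (Q1 := Rle_abs (snd (fst (c n)))); assert (Q2 := Rle_abs (snd (snd (c n)))).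
    assert (Q3 := Rabs_pos (snd (fst (c n)))); assert (Q4 := Rabs_pos (snd (snd (c n)))). lra.
  + intros n.
    assert (E : Sum (N + n) (fun i => vol2 (c i)) =
      Sum N (fun i => vol2 (c i)) + Sum n (fun i => vol2 (c (N + i)%nat))).
    { induction n as [|n IH]; [rewrite Nat.add_0_r; simpl; ring|].
      rewrite Nat.add_succ_r; cbn [Sum]; rewrite IH; ring. }
    specialize (HN (N + n)%nat); lra.
Qed.

(** * Limits over truncations *)

(** [RbarLim] picks some limit by [epsilon], so the supremum has to be shown to be the only one,
    infinite values included. *)
Lemma RbarLim_monotone (h : R -> Rbar) (y : R -> R) K :
  (forall M, h M = Fin (y M)) -> (forall M M', M <= M' -> y M <= y M') -> (forall M, y M <= K) ->
  exists l, RbarLim h = Fin l /\ (forall M, y M <= l) /\ (forall c, (forall M, y M <= c) -> l <= c).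
Proof.
intros Hh Hy HK.
destruct (completeness (fun r => exists M, r = y M)) as [l [Hl1 Hl2]].
- exists K; intros r [M ->]; auto.
- exists (y 0); eauto.
- assert (Hle : forall M, y M <= l) by (intros M; apply Hl1; eauto).
  assert (Hc : forall c, (forall M, y M <= c) -> l <= c).
  { intros c Hc; apply Hl2; intros r [M ->]; auto. }
  assert (Hnear : forall eps, eps > 0 -> exists M, forall r, M <= r -> l - eps < y r).
  { intros eps Heps; apply NNPP; intros Hn.
    assert (l <= l - eps); [|lra].
    apply Hc; intros M; apply Rnot_lt_le; intros Hlt; apply Hn; exists M.
    intros r Hr; specialize (Hy M r Hr); lra. }
  assert (Hlim : Rbar_lim_infty h (Fin l)).
  { intros eps Heps; destruct (Hnear eps Heps) as [M HM]; exists M; intros r Hr.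
    exists (y r); split; [auto|]; specialize (HM r Hr); specialize (Hle r).
    apply Rabs_def1; lra. }
  exists l; split; [|auto].
  assert (Hspec : Rbar_lim_infty h (RbarLim h)).
  { unfold RbarLim; apply epsilon_spec; eauto. }
  destruct (RbarLim h) as [l'| |].
  + f_equal; apply cond_eq; intros eps Heps.
    destruct (Hspec (eps / 2)) as [M1 H1]; [lra|].
    destruct (Hlim (eps / 2)) as [M2 H2]; [lra|].
    destruct (H1 (Rmax M1 M2) (Rmax_l _ _)) as [y1 [E1 L1]].
    destruct (H2 (Rmax M1 M2) (Rmax_r _ _)) as [y2 [E2 L2]].
    assert (y1 = y2) by congruence; subst y2.
    apply Rabs_def2 in L1; apply Rabs_def2 in L2; apply Rabs_def1; lra.
  + destruct (Hspec (l + 1)) as [M HM]; specialize (HM M (Rle_refl _)); rewrite Hh in HM.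
    simpl in HM; specialize (Hle M); lra.
  + destruct (Hspec (l - 1)) as [M1 H1]; destruct (Hnear 1 ltac:(lra)) as [M2 H2].
    specialize (H1 (Rmax M1 M2) (Rmax_l _ _)); specialize (H2 (Rmax M1 M2) (Rmax_r _ _)).
    rewrite Hh in H1; simpl in H1; lra.
Qed.

Lemma mle2_truncate Z M a : mle2 Z a -> mle2 (truncate Z M) a.
Proof. apply mle2_mono; [intros x y H; apply H|lra]. Qed.

Lemma I_bdd_mono al be Z Z' M M' a y y' : zone Z M -> zone Z' M' -> mle2 Z' a ->
  (forall x y, Z x y -> Z' x y) -> 0 <= al <= 1 -> 0 <= be <= 1 ->
  I_bdd al be Z = Fin y -> I_bdd al be Z' = Fin y' -> y <= y'.
Proof.
intros HZ HZ' Ha Hsub Hal Hbe Ey Ey'.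
destruct (I_bdd_spec al be Z M a HZ) as [z [Ez [_ [Hz _]]]]; auto.
{ apply (mle2_mono _ Z' a a); auto; lra. }
destruct (I_bdd_spec al be Z' M' a HZ') as [z' [Ez' [_ [_ Hz']]]]; auto.
assert (z = y) by congruence; assert (z' = y') by congruence; subst.
apply Hz'; intros A f g a' i1 i2 [D1 [D2 [D3 [D4 [D5 D6]]]]]; apply (Hz A f g).
repeat (split; [assumption|]); split; [|auto].
apply spans_antitone with Z'; auto; [apply HZ|apply HZ'].
Qed.

Lemma EI_spec al be Z a : zero_set Z -> area Z = Fin a -> 0 <= al <= 1 -> 0 <= be <= 1 ->
  exists y l, (forall M, I_bdd al be (truncate Z M) = Fin (y M)) /\ EI al be Z = Fin l /\
    (forall M, y M <= l) /\ (forall c, (forall M, y M <= c) -> l <= c).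
Proof.
intros HZ Ha Hal Hbe; apply lm2_Fin in Ha; destruct Ha as [Ha _].
assert (Hy : forall M, exists y, I_bdd al be (truncate Z M) = Fin y /\ y <= (1 - al) * a).
{ intros M; destruct (I_bdd_spec al be (truncate Z M) M a) as [y [Ey [Hy _]]]; auto.
  - apply zone_truncate; auto.
  - apply mle2_truncate; auto.
  - exists y; split; [auto|lra]. }
set (y := fun M => proj1_sig (constructive_indefinite_description _ (Hy M))).
assert (Ey : forall M, I_bdd al be (truncate Z M) = Fin (y M) /\ y M <= (1 - al) * a).
{ intros M; exact (proj2_sig (constructive_indefinite_description _ (Hy M))). }
destruct (RbarLim_monotone (fun M => I_bdd al be (truncate Z M)) y ((1 - al) * a)) as [l Hl].
- intros M; apply Ey.
- intros M M' HM; apply (I_bdd_mono al be (truncate Z M) (truncate Z M') M M' a); auto;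
    try apply Ey; try apply zone_truncate; try apply mle2_truncate; auto.
  intros u v [H1 [H2 H3]]; repeat split; auto; lra.
- intros M; apply Ey.
- exists y, l; split; [intros M; apply Ey|exact Hl].
Qed.

Lemma gamma_thin_spec Z a : zero_set Z -> area Z = Fin a ->
  exists y l, (forall M, gthin_bdd (truncate Z M) = Fin (y M)) /\ gamma_thin Z = Fin l /\
    (forall M, y M <= l) /\ (forall c, (forall M, y M <= c) -> l <= c).
Proof.
intros HZ Ha; apply lm2_Fin in Ha; destruct Ha as [Ha _].
assert (Hy := fun M => gthin_bdd_spec (truncate Z M) M a (zone_truncate Z M HZ) (mle2_truncate Z M a Ha)).
set (y := fun M => proj1_sig (constructive_indefinite_description _ (Hy M))).
assert (Ey := fun M => proj2_sig (constructive_indefinite_description _ (Hy M))).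
fold y in Ey; cbv beta in Ey.
destruct (RbarLim_monotone (fun M => gthin_bdd (truncate Z M)) y a) as [l Hl].
- intros M; apply (Ey M).
- intros M M' HM; destruct (Ey M) as [_ [_ [H1 _]]]; destruct (Ey M') as [_ [_ [_ H2]]].
  apply H2; intros f g i1 i2 Pf Pg Hs; apply H1; auto.
  apply spans_antitone with (truncate Z M'); auto; try apply (zone_truncate _ _ HZ).
  intros u v [G1 [G2 G3]]; repeat split; auto; lra.
- intros M; apply (Ey M).
- exists y, l; split; [intros M; apply (Ey M)|exact Hl].
Qed.

Lemma I_bdd_le_gthin al Z M a y t : zone Z M -> mle2 Z a -> 0 <= al <= 1 ->
  I_bdd al al Z = Fin y -> gthin_bdd Z = Fin t -> y <= (1 - al) * t.
Proof.
intros HZ Ha Hal Ey Et.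
destruct (I_bdd_spec al al Z M a HZ) as [z [Ez [_ [Hz _]]]]; auto.
destruct (gthin_bdd_spec Z M a HZ) as [t' [Et' [_ [_ Ht]]]]; auto.
assert (z = y) by congruence; assert (t' = t) by congruence; subst z t'.
(* At [al = 1] there is no dividing by [1 - al], but the upper bound of [I_bdd_spec] is then 0. *)
destruct (Req_dec al 1) as [->|Hal1].
- destruct (I_bdd_spec 1 1 Z M a HZ) as [z [Ez' [Hz' _]]]; auto.
  assert (z = y) by congruence; subst; lra.
- apply Rmult_le_reg_l with (/ (1 - al)); [apply Rinv_0_lt_compat; lra|].
  rewrite <- Rmult_assoc, Rinv_l, Rmult_1_l by lra.
  apply Ht; intros f g i1 i2 Pf Pg Hs H1 H2.
  specialize (Hz _ _ _ _ _ _ (admissible_thin _ _ _ _ _ Pf Pg Hs H1 H2)).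
  apply Rmult_le_reg_l with (1 - al); [lra|].
  rewrite <- Rmult_assoc, Rinv_r by lra; lra.
Qed.

Lemma I_bdd_ge_gthin al Z M a y t : zone Z M -> mle2 Z a -> 0 <= al <= 1 ->
  I_bdd al al Z = Fin y -> gthin_bdd Z = Fin t -> Rmin (1 - al) (1 / 2) * t <= y.
Proof.
intros HZ Ha Hal Ey Et.
destruct (I_bdd_spec al al Z M a HZ) as [z [Ez [_ [_ Hz]]]]; auto.
destruct (gthin_bdd_spec Z M a HZ) as [t' [Et' [_ [Ht _]]]]; auto.
assert (z = y) by congruence; assert (t' = t) by congruence; subst z t'.
apply Hz; intros A f g a' i1 i2 Hadm.
destruct (admissible_ge0 _ _ _ _ _ _ _ Hadm) as [G1 [G2 G3]].
assert (B := thin_lower_bound_le_cost Z M A f g a' i1 i2 t HZ Hadm Ht).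
set (m := Rmin (1 - al) (1 / 2)).
assert (Hm1 : m <= 1 - al) by apply Rmin_l; assert (Hm2 : m <= 1 / 2) by apply Rmin_r.
assert (Hm0 : 0 <= m) by (apply Rmin_glb; lra).
assert (m * t <= m * (i1 + i2 + 2 * a')) by (apply Rmult_le_compat_l; auto).
assert (m * (i1 + i2) <= (1 - al) * (i1 + i2)) by (apply Rmult_le_compat_r; lra).
assert (m * a' <= 1 / 2 * a') by (apply Rmult_le_compat_r; lra).
lra.
Qed.

Lemma EI_al_0_limit Z a : zero_set Z -> area Z = Fin a ->
  Rbar_lim_left (fun al => Rbar_scale (/ (1 - al)) (EI al 0 Z)) 1 (Fin a).
Proof.
intros HZ Ha eps Heps.
assert (Ha' := proj1 (lm2_Fin _ _ Ha)).
destruct (area_truncate_tail Z a (eps / 3) HZ Ha ltac:(lra)) as [M [aM [EaM HaM]]].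
destruct (I_bdd_ge_area _ M aM (eps / 3) (zone_truncate Z M HZ) EaM ltac:(lra)) as [d [Hd Hlow]].
exists (Rmin d 1); split; [apply Rmin_glb_lt; lra|].
assert (Hd1 := Rmin_l d 1); assert (Hd2 := Rmin_r d 1).
intros al Hal.
destruct (EI_spec al 0 Z a HZ Ha ltac:(lra) ltac:(lra)) as [y [l [Ey [El [Hl1 Hl2]]]]].
rewrite El; exists (/ (1 - al) * l); split; [auto|].
assert (Hup : l <= (1 - al) * a).
{ apply Hl2; intros M'.
  destruct (I_bdd_spec al 0 (truncate Z M') M' a) as [z [Ez [Hz _]]]; try lra.
  - apply zone_truncate; auto.
  - apply mle2_truncate; auto.
  - rewrite Ey in Ez; injection Ez as ->; lra. }
specialize (Hlow al (y M) ltac:(lra) ltac:(lra) (Ey M)); specialize (Hl1 M).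
assert (Hinv : 0 < / (1 - al)) by (apply Rinv_0_lt_compat; lra).
assert (U : / (1 - al) * l <= / (1 - al) * ((1 - al) * a)) by (apply Rmult_le_compat_l; lra).
assert (L : / (1 - al) * ((1 - al) * (aM - eps / 3)) <= / (1 - al) * l) by (apply Rmult_le_compat_l; lra).
rewrite <- Rmult_assoc, Rinv_l, Rmult_1_l in U, L by lra.
apply Rabs_def1; lra.
Qed.

(** For [al >= 1 / 2] the minimum in [I_bdd_ge_gthin] is [1 - al], so it meets the upper bound of
    [I_bdd_le_gthin]. *)
Lemma EI_diag_eq al Z a t : zero_set Z -> area Z = Fin a -> 1 / 2 <= al < 1 -> gamma_thin Z = Fin t ->
  EI al al Z = Fin ((1 - al) * t).
Proof.
intros HZ Ha Hal Et.
assert (Ha' := proj1 (lm2_Fin _ _ Ha)).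
destruct (EI_spec al al Z a HZ Ha ltac:(lra) ltac:(lra)) as [y [l [Ey [El [Hl1 Hl2]]]]].
destruct (gamma_thin_spec Z a HZ Ha) as [z [t' [Ez [Et' [Ht1 Ht2]]]]].
assert (t' = t) by congruence; subst t'; rewrite El; f_equal; apply Rle_antisym.
- apply Hl2; intros M; apply Rle_trans with ((1 - al) * z M).
  + apply (I_bdd_le_gthin al (truncate Z M) M a); auto using zone_truncate, mle2_truncate; lra.
  + apply Rmult_le_compat_l; [lra|auto].
- apply Rmult_le_reg_l with (/ (1 - al)); [apply Rinv_0_lt_compat; lra|].
  rewrite <- Rmult_assoc, Rinv_l, Rmult_1_l by lra.
  apply Ht2; intros M; apply Rmult_le_reg_l with (1 - al); [lra|].
  rewrite <- Rmult_assoc, Rinv_r, Rmult_1_l by lra.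
  apply Rle_trans with (y M); [|auto].
  assert (B := I_bdd_ge_gthin al (truncate Z M) M a (y M) (z M)).
  rewrite Rmin_left in B by lra.
  apply B; auto using zone_truncate, mle2_truncate; lra.
Qed.

Lemma EI_diag_limit Z a : zero_set Z -> area Z = Fin a ->
  Rbar_lim_left (fun al => Rbar_scale (/ (1 - al)) (EI al al Z)) 1 (gamma_thin Z).
Proof.
intros HZ Ha.
destruct (gamma_thin_spec Z a HZ Ha) as [_ [t [_ [Et _]]]]; rewrite Et.
intros eps Heps; exists (1 / 2); split; [lra|]; intros al Hal.
rewrite (EI_diag_eq al Z a t HZ Ha ltac:(lra) Et).
exists t; split; [simpl; f_equal; field; lra|].
rewrite Rminus_diag, Rabs_R0; auto.
Qed.

(** * The extremal ratio *)

Lemma positive_point Z a : zero_set Z -> area Z = Fin a -> 0 < a ->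
  exists x y, Z x y /\ 0 < x /\ 0 < y.
Proof.
intros [_ [_ [_ Hcl]]] Ha Hpos; apply NNPP; intros Hn.
apply lm2_Fin in Ha; assert (a <= 0); [|lra].
apply Ha, mle2_empty; intros x y Hxy.
apply Hcl in Hxy; destruct (Hxy 1 ltac:(lra)) as [u [v [H _]]]; eauto.
Qed.

(** A rectangle of sides [x], [y] inside [Z] forces thin cost at least [x * y], hence gamma at least
    half of that. Positivity puts [ratio_val] in its ordinary branch. *)
Lemma gamma_pos Z a : zero_set Z -> area Z = Fin a -> 0 < a -> exists c, gamma Z = Fin c /\ 0 < c.
Proof.
intros HZ Ha Hpos; assert (Ha' := proj1 (lm2_Fin _ _ Ha)).
destruct (positive_point Z a HZ Ha Hpos) as [x [y [Hxy [Hx Hy]]]].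
destruct (EI_spec 0 0 Z a HZ Ha ltac:(lra) ltac:(lra)) as [w [l [Ew [El [Hl1 _]]]]].
exists l; split; [auto|].
set (M := Rmax x y).
destruct (gthin_bdd_spec (truncate Z M) M a (zone_truncate Z M HZ) (mle2_truncate Z M a Ha'))
  as [t [Et [_ [_ Ht]]]].
assert (Hxyt : x * y <= t).
{ apply Ht; intros f g i1 i2 Pf Pg Hs H1 H2.
  apply (thin_ge_rectangle (truncate Z M) f g i1 i2 x y); auto; try lra.
  - apply (zone_truncate Z M HZ).
  - split; [auto|split; [apply Rmax_l|apply Rmax_r]]. }
assert (B := I_bdd_ge_gthin 0 (truncate Z M) M a (w M) t (zone_truncate Z M HZ)
  (mle2_truncate Z M a Ha') ltac:(lra) (Ew M) Et).
rewrite Rmin_right in B by lra.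
assert (0 < x * y) by (apply Rmult_lt_0_compat; auto).
specialize (Hl1 M); lra.
Qed.

(** Two bounds combined: the cost decreases in [al], so [l <= c]; and [l] is at most [1 - al] times
    the thin cost, which is at most [2 * c]. *)
Lemma EI_diag_le_gamma al Z a l c : zero_set Z -> area Z = Fin a -> 0 <= al <= 1 ->
  EI al al Z = Fin l -> gamma Z = Fin c -> l <= 2 * Rmin (1 - al) (1 / 2) * c.
Proof.
intros HZ Ha Hal El Ec; assert (Ha' := proj1 (lm2_Fin _ _ Ha)).
destruct (EI_spec al al Z a HZ Ha Hal Hal) as [y [l' [Ey [El' [Hl1 Hl2]]]]].
destruct (EI_spec 0 0 Z a HZ Ha ltac:(lra) ltac:(lra)) as [w [c' [Ew [Ec' [Hc1 Hc2]]]]].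
unfold gamma in Ec.
assert (l' = l) by congruence; assert (c' = c) by congruence; subst l' c'.
apply Hl2; intros M.
assert (HM := zone_truncate Z M HZ); assert (HaM := mle2_truncate Z M a Ha').
destruct (I_bdd_spec 0 0 (truncate Z M) M a HM HaM ltac:(lra) ltac:(lra)) as [w' [Ew' [Hw0 [_ Hw]]]].
destruct (I_bdd_spec al al (truncate Z M) M a HM HaM Hal Hal) as [y' [Ey' [_ [Hy _]]]].
destruct (gthin_bdd_spec (truncate Z M) M a HM HaM) as [t [Et _]].
assert (w' = w M) by (rewrite Ew in Ew'; congruence).
assert (y' = y M) by (rewrite Ey in Ey'; congruence); subst w' y'.
assert (B1 : y M <= w M).
{ apply Hw; intros A f g a' i1 i2 Hadm; specialize (Hy _ _ _ _ _ _ Hadm).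
  destruct (admissible_ge0 _ _ _ _ _ _ _ Hadm) as [G1 [G2 G3]].
  assert (0 <= al * i1) by (apply Rmult_le_pos; lra).
  assert (0 <= al * i2) by (apply Rmult_le_pos; lra). lra. }
assert (B2 := I_bdd_le_gthin al _ M a _ _ HM HaM Hal (Ey M) Et).
assert (B3 := I_bdd_ge_gthin 0 _ M a _ _ HM HaM ltac:(lra) (Ew M) Et).
rewrite (Rmin_right (1 - 0)) in B3 by lra.
specialize (Hc1 M).
unfold Rmin; destruct (Rle_dec (1 - al) (1 / 2)); [|lra].
apply Rle_trans with (1 := B2).
rewrite (Rmult_comm 2), Rmult_assoc; apply Rmult_le_compat_l; lra.
Qed.

(* Thin spanning must pay for both arms, while a diagonal of small squares serves both at once. *)
Definition Lshape (d x y : R) : Prop :=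
  0 <= x /\ 0 <= y /\ ((x <= 1 /\ y <= d) \/ (x <= d /\ y <= 1)).

Lemma zone_Lshape d : 0 < d < 1 -> zone (Lshape d) 1.
Proof.
intros Hd; split.
- intros a b H x y Hx Hy; unfold Lshape in *; lra.
- intros x y H; unfold Lshape in *; lra.
Qed.

Lemma zero_set_Lshape d : 0 < d < 1 -> zero_set (Lshape d).
Proof.
intros Hd.
assert (Hcl : is_closed2 (Lshape d)).
{ intros x y H.
  assert (Hx : 0 <= x).
  { apply Rnot_lt_le; intros Hlt; destruct (H (- x)) as [u [v [HL [H1 _]]]]; [lra|].
    apply Rabs_def2 in H1; unfold Lshape in HL; lra. }
  assert (Hy : 0 <= y).
  { apply Rnot_lt_le; intros Hlt; destruct (H (- y)) as [u [v [HL [_ H1]]]]; [lra|].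
    apply Rabs_def2 in H1; unfold Lshape in HL; lra. }
  assert (Hx1 : x <= 1).
  { apply Rnot_lt_le; intros Hlt; destruct (H (x - 1)) as [u [v [HL [H1 _]]]]; [lra|].
    apply Rabs_def2 in H1; unfold Lshape in HL; lra. }
  assert (Hy1 : y <= 1).
  { apply Rnot_lt_le; intros Hlt; destruct (H (y - 1)) as [u [v [HL [_ H1]]]]; [lra|].
    apply Rabs_def2 in H1; unfold Lshape in HL; lra. }
  destruct (Rle_dec x d) as [|Hxd]; [unfold Lshape; lra|].
  destruct (Rle_dec y d) as [|Hyd]; [unfold Lshape; lra|].
  exfalso; destruct (H (Rmin (x - d) (y - d))) as [u [v [HL [H1 H2]]]]; [apply Rmin_glb_lt; lra|].
  assert (M1 := Rmin_l (x - d) (y - d)); assert (M2 := Rmin_r (x - d) (y - d)).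
  apply Rabs_def2 in H1; apply Rabs_def2 in H2; unfold Lshape in HL; lra. }
split; [intros x y H; unfold Lshape in H; split; lra|].
split; [auto|split; [apply (zone_Lshape d Hd)|]].
intros x y; split.
- intros H eps Heps.
  set (r := Rmin (eps / 2) d).
  assert (Hr1 : r <= eps / 2) by apply Rmin_l; assert (Hr2 : r <= d) by apply Rmin_r.
  assert (Hr0 : 0 < r) by (apply Rmin_glb_lt; lra).
  (* Raising both coordinates to at least [r <= d] makes them positive without leaving the
     L-shape. *)
  exists (Rmax x r), (Rmax y r); unfold Lshape in *; unfold Rmax.
  destruct (Rle_dec x r), (Rle_dec y r); (split; [lra|split; apply Rabs_def1; lra]).
- intros H; apply Hcl; intros eps Heps.
  destruct (H eps Heps) as [u [v [[HL _] H']]]; eauto.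
Qed.

Lemma area_Lshape d : 0 < d < 1 -> exists a, area (Lshape d) = Fin a /\ 0 < a.
Proof.
intros Hd; destruct (lm2_le (Lshape d) ((1 - 0) * (1 - 0))) as [a [Ea [Ma _]]].
- apply mle2_rectangle; try lra; intros x y H; unfold Lshape in H; lra.
- exists a; split; [auto|].
  assert ((1 - 0) * (d - 0) <= a); [|lra].
  apply (mle2_ge (Lshape d)); auto; try lra; intros x y Hx Hy; unfold Lshape; lra.
Qed.

(** The corner (d, 1) charges a rectangle to [f] below height [d] and [g] above it; the corner (1,
    d) charges one to [f] above [d] and [g] below it. The four pieces come from cuts at height [d],
    so the two bounds add. *)
Lemma thin_Lshape_ge d f g i1 i2 : 0 < d < 1 -> profile f -> profile g ->
  spans (Lshape d) f g (fun _ _ => False) -> integral0 f = Fin i1 -> integral0 g = Fin i2 ->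
  2 * (d * (1 - d)) <= i1 + i2.
Proof.
intros Hd Pf Pg Hs H1 H2; assert (DZ := proj1 (zone_Lshape d Hd)).
apply integral0_Fin in H1; destruct H1 as [H1 _]; apply integral0_Fin in H2; destruct H2 as [H2 _].
assert (Split : forall h i, mle2 (subgraph h) i -> exists s1 s2,
  mle2 (fun x y => subgraph h x y /\ y <= d) s1 /\ mle2 (fun x y => subgraph h x y /\ d <= y) s2 /\
  s1 + s2 <= i).
{ intros h i; apply mle2_split_y with (c := d); auto. }
destruct (Split f i1 H1) as [f1 [f2 [F1 [F2 Hf]]]], (Split g i2 H2) as [g1 [g2 [G1 [G2 Hg]]]].
assert (B1 : d * (1 - d) <= f1 + g2).
{ apply (rectangle_le_mle2 _ _ d (1 - d) d 1 f1 g2) with (3 := F1) (4 := G2); try lra.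
  intros t v Ht Hv.
  assert (Hbar := thin_spans_barrier _ f g t v DZ Pf Pg Hs ltac:(lra) ltac:(lra)).
  assert (0 <= f v) by (apply Pf; lra); assert (0 <= g t) by (apply Pg; lra).
  unfold subgraph, Lshape in *; lra. }
assert (B2 : (1 - d) * d <= f2 + g1).
{ apply (rectangle_le_mle2 _ _ (1 - d) d 1 d f2 g1) with (3 := F2) (4 := G1); try lra.
  intros t v Ht Hv.
  assert (Hbar := thin_spans_barrier _ f g t v DZ Pf Pg Hs ltac:(lra) ltac:(lra)).
  assert (0 <= f v) by (apply Pf; lra); assert (0 <= g t) by (apply Pg; lra).
  unfold subgraph, Lshape in *; lra. }
lra.
Qed.

Definition diagonal_squares (N : nat) (l x y : R) : Prop :=
  exists k, (k < N)%nat /\ (INR k * l <= x <= INR (S k) * l /\ INR k * l <= y <= INR (S k) * l).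

Lemma is_closed2_square a b c d : is_closed2 (fun x y => a <= x <= b /\ c <= y <= d).
Proof.
intros x y H; repeat split; apply Rnot_lt_le; intros Hlt.
- destruct (H (a - x)) as [u [v [Hs [H1 H2]]]]; [lra|]; apply Rabs_def2 in H1; lra.
- destruct (H (x - b)) as [u [v [Hs [H1 H2]]]]; [lra|]; apply Rabs_def2 in H1; lra.
- destruct (H (c - y)) as [u [v [Hs [H1 H2]]]]; [lra|]; apply Rabs_def2 in H2; lra.
- destruct (H (y - d)) as [u [v [Hs [H1 H2]]]]; [lra|]; apply Rabs_def2 in H2; lra.
Qed.

Lemma is_closed2_finite n (E : nat -> R -> R -> Prop) :
  (forall k, is_closed2 (E k)) -> is_closed2 (fun x y => exists k, (k < n)%nat /\ E k x y).
Proof.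
intros HE; induction n as [|n IH]; intros x y H.
- destruct (H 1) as [u [v [[k [Hk _]] _]]]; [lra|lia].
- destruct (classic (closure2 (E n) x y)) as [Hn|Hn].
  { exists n; split; [lia|apply HE; auto]. }
  destruct (IH x y) as [k [Hk Ek]]; [|exists k; split; [lia|auto]].
  intros eps Heps.
  assert (Hd : exists d, d > 0 /\ forall u v, E n u v -> ~ (Rabs (u - x) < d /\ Rabs (v - y) < d)).
  { apply NNPP; intros Hc; apply Hn; intros d Hd; apply NNPP; intros Hc'.
    apply Hc; exists d; split; auto; intros u v Huv [G1 G2]; apply Hc'; eauto. }
  destruct Hd as [d [Hd Hd']].
  assert (M1 := Rmin_l eps d); assert (M2 := Rmin_r eps d).
  destruct (H (Rmin eps d)) as [u [v [[k [Hk Ek]] [G1 G2]]]]; [apply Rmin_glb_lt; auto|].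
  exists u, v; split; [|split; lra].
  destruct (Nat.eq_dec k n) as [->|]; [exfalso; apply (Hd' u v Ek); lra|].
  exists k; split; [lia|auto].
Qed.

Lemma diagonal_squares_admissible N l d : (0 < N)%nat -> 0 < d < 1 -> d < l -> 1 < INR N * l ->
  exists a, admissible (Lshape d) (diagonal_squares N l) (fun _ => 0) (fun _ => 0) a 0 0 /\
    a <= INR N * (l * l).
Proof.
intros HN Hd Hdl HNl.
assert (grid_ge0 : forall i, 0 <= INR i * l).
{ intros i; apply Rmult_le_pos; [apply pos_INR|lra]. }
destruct (lm2_le (diagonal_squares N l) (INR N * (l * l))) as [a [Ea [Ma La]]].
{ rewrite <- Sum_const.
  apply (mle2_finite N (fun k x y => INR k * l <= x <= INR (S k) * l /\ INR k * l <= y <= INR (S k) * l)).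
  intros k _; replace (l * l) with ((INR (S k) * l - INR k * l) * (INR (S k) * l - INR k * l))
    by (rewrite S_INR; ring).
  apply mle2_rectangle; auto; rewrite S_INR; lra. }
assert (Hcov : forall v, 0 <= v <= INR N * l ->
  exists k, (k < N)%nat /\ INR k * l <= v <= INR (S k) * l).
{ intros v Hv; destruct (grid_cell_right N l v Hv) as [i [Hi [_ Hi']]]; [lia|eauto]. }
exists a; split; [|auto].
split; [split|split; [|split; [|split; [|split; [|split; [|split]]]]]];
  auto using profile_zero, integral0_zero.
- apply is_closed2_finite; intros k; apply is_closed2_square.
- exists (INR N * l); intros x y [k [Hk [Hx Hy]]].
  assert (INR (S k) * l <= INR N * l) by (apply Rmult_le_compat_r; [lra|apply le_INR; lia]).
  specialize (grid_ge0 k); rewrite !Rabs_right by lra; lra.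
- intros x y [k [Hk [Hx Hy]]]; specialize (grid_ge0 k); split; lra.
(* One step fills the square of side [INR N * l > 1]: each of its rows and columns crosses a
   diagonal square of side [l > d], and (l, l) lies outside the L-shape. *)
- apply (spans_of_large_square _ _ _ _ 1 1 (INR N * l)); auto using profile_zero; try lra.
  + apply zone_Lshape; auto.
  + apply zone_le, zone_Lshape; auto.
  + intros u v Hu Hv; split; [split; lra|right]; intros Hin.
    apply inZbar_iff in Hin; try lra; [|apply zone_Lshape; auto].
    destruct Hin as [s1 [s2 [R1 [R2 HZ]]]].
    destruct (Hcov v Hv) as [k [Hk Hkv]], (Hcov u Hu) as [j [Hj Hju]].
    assert (B1 : INR (S k) * l - INR k * l <= s1).
    { apply mle1_ge with (2 := R1); intros x Hx; exists k; split; [auto|split; lra]. }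
    assert (B2 : INR (S j) * l - INR j * l <= s2).
    { apply mle1_ge with (2 := R2); intros x Hx; exists j; split; [auto|split; lra]. }
    rewrite S_INR in B1, B2; unfold Lshape in HZ; lra.
Qed.

Lemma gamma_Lshape_le N c : (2 <= N)%nat -> gamma (Lshape (/ INR N)) = Fin c -> c <= / INR N.
Proof.
intros HN Ec.
assert (HN2 : 2 <= INR N) by (replace 2 with (INR 2) by reflexivity; apply le_INR; auto).
set (d := / INR N) in *.
assert (HNd : INR N * d = 1) by (unfold d; field; lra).
assert (Hd0 : 0 < d) by (apply Rinv_0_lt_compat; lra).
assert (Hd : 0 < d < 1).
{ split; [auto|]; assert (2 * d <= INR N * d) by (apply Rmult_le_compat_r; lra); lra. }
destruct (area_Lshape d Hd) as [a [Ea _]]; assert (Ma := proj1 (lm2_Fin _ _ Ea)).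
destruct (I_bdd_spec 0 0 (Lshape d) 1 a (zone_Lshape d Hd) Ma ltac:(lra) ltac:(lra))
  as [y [Ey [_ [Hy _]]]].
assert (Hyd : y <= d).
{ apply Rnot_lt_le; intros Hlt.
  (* Squares of side [d * (1 + e)] have total area at most [d + 3 * (d * e)], and this choice keeps
     it below [y]. *)
  set (e := Rmin 1 ((y - d) / (4 * d))).
  assert (He0 : 0 < e) by (apply Rmin_glb_lt; [lra|apply Rdiv_lt_0_compat; lra]).
  assert (He1 : e <= 1) by apply Rmin_l.
  assert (He2 : d * e <= (y - d) / 4).
  { apply Rle_trans with (d * ((y - d) / (4 * d))); [apply Rmult_le_compat_l; [lra|apply Rmin_r]|].
    right; field; lra. }
  assert (Hde : 0 < d * e) by (apply Rmult_lt_0_compat; lra).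
  destruct (diagonal_squares_admissible N (d * (1 + e)) d) as [a' [Hadm Ha']]; auto; try lia; try lra.
  { rewrite <- Rmult_assoc, HNd; lra. }
  specialize (Hy _ _ _ _ _ _ Hadm).
  replace (INR N * (d * (1 + e) * (d * (1 + e)))) with (INR N * d * (d + 2 * (d * e) + d * e * e)) in Ha' by ring.
  rewrite HNd in Ha'.
  assert (d * e * e <= d * e * 1) by (apply Rmult_le_compat_l; lra). lra. }
destruct (EI_spec 0 0 (Lshape d) a (zero_set_Lshape d Hd) Ea ltac:(lra) ltac:(lra))
  as [w [c' [Ew [Ec' [_ Hc2]]]]].
unfold gamma in Ec; assert (c' = c) by congruence; subst c'.
apply Hc2; intros M; apply Rle_trans with y; [|auto].
apply (I_bdd_mono 0 0 (truncate (Lshape d) M) (Lshape d) M 1 a); auto; try lra.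
- apply zone_truncate, zero_set_Lshape; auto.
- apply zone_Lshape; auto.
- intros u v H; apply H.
Qed.

Lemma truncate_Lshape d : 0 < d < 1 -> truncate (Lshape d) 1 = Lshape d.
Proof.
intros Hd; apply functional_extensionality; intros x; apply pred_ext; intros y.
unfold truncate, Lshape; lra.
Qed.

Lemma EI_Lshape_ge d al l : 0 < d < 1 -> 0 <= al <= 1 -> EI al al (Lshape d) = Fin l ->
  2 * Rmin (1 - al) (1 / 2) * (d * (1 - d)) <= l.
Proof.
intros Hd Hal El.
destruct (area_Lshape d Hd) as [a [Ea _]]; assert (Ma := proj1 (lm2_Fin _ _ Ea)).
destruct (EI_spec al al (Lshape d) a (zero_set_Lshape d Hd) Ea Hal Hal) as [y [l' [Ey [El' [Hl1 _]]]]].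
assert (l' = l) by congruence; subst l'.
specialize (Ey 1); rewrite truncate_Lshape in Ey by auto.
destruct (gthin_bdd_spec (Lshape d) 1 a (zone_Lshape d Hd) Ma) as [t [Et [_ [_ Ht]]]].
assert (Htd : 2 * (d * (1 - d)) <= t).
{ apply Ht; intros f g i1 i2 Pf Pg Hs H1 H2; apply (thin_Lshape_ge d f g); auto. }
assert (B := I_bdd_ge_gthin al _ 1 a _ _ (zone_Lshape d Hd) Ma Hal Ey Et).
specialize (Hl1 1).
assert (Hm : 0 <= Rmin (1 - al) (1 / 2)) by (apply Rmin_glb; lra).
assert (Rmin (1 - al) (1 / 2) * (2 * (d * (1 - d))) <= Rmin (1 - al) (1 / 2) * t)
  by (apply Rmult_le_compat_l; auto).
lra.
Qed.

Lemma sup_ratio_eq al : 0 < al < 1 -> sup_ratio al = Fin (2 * Rmin (1 - al) (1 / 2)).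
Proof.
intros Hal; unfold sup_ratio; apply Rbar_sup_unique; split.
- intros w [Z [a [HZ [Ha [Hpos ->]]]]].
  destruct (EI_spec al al Z a HZ Ha ltac:(lra) ltac:(lra)) as [_ [l [_ [El _]]]].
  destruct (gamma_pos Z a HZ Ha Hpos) as [c [Ec Hc]].
  rewrite El, Ec; simpl; destruct (Rlt_dec 0 c); [simpl|lra].
  assert (B := EI_diag_le_gamma al Z a l c HZ Ha ltac:(lra) El Ec).
  apply Rmult_le_reg_l with c; [auto|].
  rewrite <- Rmult_assoc, Rinv_r, Rmult_1_l by lra; lra.
- intros w Hw.
  assert (Key : forall N, (2 <= N)%nat ->
    Rbar_le (Fin (2 * Rmin (1 - al) (1 / 2) * (1 - / INR N))) w).
  { intros N HN.
    assert (HN2 : 2 <= INR N) by (replace 2 with (INR 2) by reflexivity; apply le_INR; auto).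
    set (d := / INR N).
    assert (Hd0 : 0 < d) by (apply Rinv_0_lt_compat; lra).
    assert (Hd : 0 < d < 1).
    { split; [auto|]; assert (2 * d <= INR N * d) by (apply Rmult_le_compat_r; lra).
      assert (INR N * d = 1) by (unfold d; field; lra); lra. }
    destruct (area_Lshape d Hd) as [a [Ea Hpos]].
    assert (HZ := zero_set_Lshape d Hd).
    destruct (EI_spec al al _ a HZ Ea ltac:(lra) ltac:(lra)) as [_ [l [_ [El _]]]].
    destruct (gamma_pos _ a HZ Ea Hpos) as [c [Ec Hc]].
    assert (Hcd := gamma_Lshape_le N c HN Ec); fold d in Hcd.
    assert (B := EI_Lshape_ge d al l Hd ltac:(lra) El).
    specialize (Hw (ratio_val (EI al al (Lshape d)) (gamma (Lshape d)))).
    specialize (Hw ltac:(exists (Lshape d), a; auto)).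
    rewrite El, Ec in Hw; simpl in Hw; destruct (Rlt_dec 0 c); [simpl in Hw|lra].
    (* Dividing the lower bound for [l] by [c <= d] cancels the factor [d]; the remaining [1 - d]
       tends to 1 as [N] grows. *)
    assert (Hle : 2 * Rmin (1 - al) (1 / 2) * (1 - d) <= / c * l).
    { apply Rmult_le_reg_l with c; [auto|].
      replace (c * (/ c * l)) with l by (field; lra).
      apply Rle_trans with (2 := B).
      assert (Hm : 0 <= Rmin (1 - al) (1 / 2)) by (apply Rmin_glb; lra).
      replace (2 * Rmin (1 - al) (1 / 2) * (d * (1 - d)))
        with (d * (2 * Rmin (1 - al) (1 / 2) * (1 - d))) by ring.
      apply Rmult_le_compat_r; [apply Rmult_le_pos; lra|auto]. }
    destruct w; simpl in *; auto; lra. }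
  destruct w as [w| |]; simpl; auto; [|exact (Key 2%nat (le_n 2))].
  simpl in Key.
  apply Rnot_lt_le; intros Hlt.
  set (m := 2 * Rmin (1 - al) (1 / 2)) in *.
  assert (Hm0 : 0 < m).
  { assert (0 < Rmin (1 - al) (1 / 2)) by (apply Rmin_glb_lt; lra); unfold m; lra. }
  (* For N above [m / (m - w)] the ratio bound [m * (1 - / N)] exceeds [w]. *)
  destruct (INR_unbounded (m / (m - w))) as [n Hn].
  specialize (Key (S (S n)) ltac:(lia)).
  assert (HN : INR n < INR (S (S n))) by (apply lt_INR; lia).
  set (x := INR (S (S n))) in *.
  assert (Hx : 0 < x) by (apply lt_0_INR; lia).
  assert (m < x * (m - w)).
  { apply Rle_lt_trans with (m / (m - w) * (m - w)); [right; field; lra|].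
    apply Rmult_lt_compat_r; lra. }
  assert (x * (m * (1 - / x)) <= x * w) by (apply Rmult_le_compat_l; lra).
  replace (x * (m * (1 - / x))) with (x * m - m) in * by (field; lra).
  lra.
Qed.

Theorem mainTheorem6 :
  (forall (Z : R -> R -> Prop) (a : R), zero_set Z -> area Z = Fin a ->
     Rbar_lim_left (fun al => Rbar_scale (/ (1 - al)) (EI al 0 Z)) 1 (Fin a) /\
     Rbar_lim_left (fun al => Rbar_scale (/ (1 - al)) (EI al al Z)) 1 (gamma_thin Z)) /\
  (forall eps, eps > 0 -> exists d, d > 0 /\ forall al, 0 < al < d ->
     exists s, sup_ratio al = Fin s /\ Rabs (s - 1) <= eps * al) /\
  (forall eps, eps > 0 -> exists d, d > 0 /\ forall al, 1 - d < al < 1 ->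
     exists s, sup_ratio al = Fin s /\ Rabs (s - 2 * (1 - al)) <= eps * (1 - al)).
Proof.
split; [|split].
- intros Z a HZ Ha; split; [apply EI_al_0_limit; auto|apply EI_diag_limit with a; auto].
(* On each side of 1/2 the closed form of [sup_ratio] equals the claimed leading term, so both error
   terms are 0. *)
- intros eps Heps; exists (1 / 2); split; [lra|]; intros al Hal.
  exists 1; rewrite sup_ratio_eq, Rmin_right by lra; split; [f_equal; field|].
  rewrite Rminus_diag, Rabs_R0; apply Rmult_le_pos; lra.
- intros eps Heps; exists (1 / 2); split; [lra|]; intros al Hal.
  exists (2 * (1 - al)); rewrite sup_ratio_eq, Rmin_left by lra; split; [auto|].
  rewrite Rminus_diag, Rabs_R0; apply Rmult_le_pos; lra.
Qed.
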